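(* Let $\mathbf{X}\in\mathbb{R}^{n\times p}$ be deterministic, $\beta^*\in\mathbb{R}^p$, and $y=\mathbf{X}\beta^*+\varepsilon$ with $\varepsilon\sim N(0,\sigma^2I_{n\times n})$, $\sigma>0$. Let $h:\mathbb{R}^p\to[0,+\infty]$ be a convex, proper function such that the minimization problem $\min_{\beta\in\mathbb{R}^p}\|\mathbf{A}\beta-z\|^2+2h(\beta)$ has at least one solution for every $z\in\mathbb{R}^n$ and every $\mathbf{A}\in\mathbb{R}^{n\times p}$, and let $\hat\beta\in\operatorname*{argmin}_{\beta\in\mathbb{R}^p}\|\mathbf{X}\beta-y\|^2+2h(\beta)$. Assume that the infimum $$t_c=\inf_{\beta\in\mathbb{R}^p:\ h(\beta)<+\infty}\|\mathbf{X}(\beta-\beta^* )\|$$ is attained. If $t_f$ is the unique maximizer of $f$, then $$\Big|\sqrt{t_f}-\sqrt m\Big|\ \le\ \sqrt{21\sigma/2}\ \le\ 3.25\sqrt\sigma,$$ $$\Big|\sqrt{t_f}-\sqrt{\mathbb{E}\big[\|\mathbf{X}(\hat\beta-\beta^* )\|\big]}\Big|\ \le\ \sqrt\sigma\big(\sqrt{21/2}+(\pi/2)^{1/4}\big)\ \le\ 4.40\sqrt\sigma,$$ where $m$ is the median of the random variable $\|\mathbf{X}(\hat\beta-\beta^* )\|$.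
   Context: $\|\cdot\|$ is the Euclidean norm. A function is proper if it is finite at at least one point. For $t\ge0$ define the random variable $$F(t)=\sup_{\beta\in\mathbb{R}^p:\ \|\mathbf{X}(\beta-\beta^* )\|\le t}\big(\varepsilon^T\mathbf{X}(\beta-\beta^* )-h(\beta)\big)-t^2/2$$ (supremum over an empty set equal to $-\infty$), and define $f:[0,+\infty)\to[-\infty,+\infty)$ by $f(t)=\mathbb{E}[F(t)]$, the expectation being over $\varepsilon\sim N(0,\sigma^2I_{n\times n})$. *)

(* Defs.v *)
From HB Require Import structures.
From mathcomp Require Import all_boot all_order all_algebra.
From mathcomp Require Import all_classical all_reals all_analysis.

Set Implicit Arguments.
Unset Strict Implicit.
Unset Printing Implicit Defensive.

Import Order.TTheory GRing.Theory Num.Theory.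
Import numFieldNormedType.Exports.

Local Open Scope classical_set_scope.
Local Open Scope ring_scope.

(* The norm `|v| that MathComp-Analysis puts on matrices is the sup norm,
   hence a separate definition. *)
Definition l2norm (R : realType) (n : nat) (v : 'cV[R]_n) : R :=
  Num.sqrt (\sum_(i < n) v i 0 ^+ 2).

Definition argmin (R : realType) (T : Type) (g : T -> \bar R) : set T :=
  [set x | forall y, (g x <= g y)%E].

Definition argmax_on (R : realType) (T : Type) (D : set T) (g : T -> \bar R) :
    set T :=
  [set x | D x /\ forall y, D y -> (g y <= g x)%E].

Definition proper_fun (R : realType) (T : Type) (h : T -> \bar R) : Prop :=
  exists x, h x \is a fin_num.

(* The values a = 0 and a = 1 are harmless because 0 * +oo = 0 in \bar R. *)
Definition econvex (R : realType) (V : lmodType R) (h : V -> \bar R) : Prop :=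
  forall (x y : V) (a : R), 0 <= a <= 1 ->
    (h (a *: x + (1 - a) *: y)%R <= a%:E * h x + (1 - a)%:E * h y)%E.

Definition penalized_ls (R : realType) (n p : nat) (h : 'cV[R]_p -> \bar R)
    (A : 'M[R]_(n, p)) (z : 'cV[R]_n) (beta : 'cV[R]_p) : \bar R :=
  ((l2norm (A *m beta - z)%R ^+ 2)%:E + 2%:E * h beta)%E.

(* N(0, s^2 I_n) is the n-fold product of N(0, s^2), which is determined by its
   values on measurable boxes; normal_prob takes the standard deviation. *)
Definition gaussian_noise (R : realType) (d : measure_display)
    (Omega : measurableType d) (P : probability Omega R) (n : nat) (s : R)
    (eps : Omega -> 'cV[R]_n) : Prop :=
  (forall i : 'I_n, measurable_fun [set: Omega] (fun w => eps w i 0)) /\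
  (forall B : 'I_n -> set R, (forall i, measurable (B i)) ->
    P [set w | forall i : 'I_n, B i (eps w i 0)] =
      (\prod_(i < n) normal_prob 0 s (B i))%E).

Definition is_median (R : realType) (d : measure_display)
    (Omega : measurableType d) (P : probability Omega R) (Z : Omega -> R)
    (m : R) : Prop :=
  ((2^-1)%:E <= P [set w | Z w <= m]%R)%E /\
  ((2^-1)%:E <= P [set w | m <= Z w]%R)%E.

(* F(t) for a given noise vector e; recall ereal_sup set0 = -oo. *)
Definition Fsup (R : realType) (n p : nat) (X : 'M[R]_(n, p))
    (betas : 'cV[R]_p) (h : 'cV[R]_p -> \bar R) (e : 'cV[R]_n) (t : R) :
    \bar R :=
  (ereal_sup
     [set ((e^T *m X *m (beta - betas)) 0 0)%R%:E - h beta |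
        beta in [set beta | (l2norm (X *m (beta - betas)) <= t)%R]]
   - (t ^+ 2 / 2)%:E)%E.

(* The integral is that of an extended-real-valued function, so the expectation
   notation, which is for real-valued functions, does not apply. *)
Definition fexp (R : realType) (d : measure_display) (Omega : measurableType d)
    (P : probability Omega R) (n p : nat) (X : 'M[R]_(n, p))
    (betas : 'cV[R]_p) (h : 'cV[R]_p -> \bar R) (eps : Omega -> 'cV[R]_n)
    (t : R) : \bar R :=
  (\int[P]_w Fsup X betas h (eps w) t)%E.

Definition tcrit (R : realType) (n p : nat) (X : 'M[R]_(n, p))
    (betas : 'cV[R]_p) (h : 'cV[R]_p -> \bar R) : R :=
  inf [set l2norm (X *m (beta - betas)) |
         beta in [set beta | (h beta < +oo)%E]].

(* Main.v *)
(* For fixed noise e, let S(t) be the supremum in F(t). It is concave in t, and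
   Z = |X (hatbeta - betas)| is a slope of S at t = Z (first-order optimality of
   hatbeta), so S(s) - S(t) >= Z (s - t) whenever s lies between t and Z. In the
   same way tf is a slope of E S at tf, because it maximizes E S(t) - t^2/2.
   Subtracting, (Z - tf)(s - tf) <= (S(s) - S(tf)) - E(S(s) - S(tf)) for s
   between tf and Z. As a function of e, S(t) is a supremum of affine functions
   with gradients of norm at most t, so the Gaussian Poincare inequality gives
   Var S(t) <= sigma^2 t^2, and the right-hand side has second moment at most
   2 sigma^2 (s^2 + tf^2). Second-moment bounds at a suitable s then locate both
   the median and the mean of Z.

   The Poincare inequality follows from the one-dimensional one by the
   Efron-Stein inequality; it is extended from smooth functions to suprema of
   affine functions by approximating a maximum with log-sum-exp. The second
   moment bounds locate the mean as sharply as the median, so the additional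
   (pi/2)^(1/4) of the second estimate is slack here. *)
Require Import Defs.
From HB Require Import structures.
From mathcomp Require Import all_boot all_order all_algebra.
From mathcomp Require Import all_classical all_reals all_analysis.
From mathcomp Require Import measurable_realfun ring lra.

Set Implicit Arguments.
Unset Strict Implicit.
Unset Printing Implicit Defensive.

Import Order.TTheory GRing.Theory Num.Theory.
Import numFieldNormedType.Exports.

Local Open Scope classical_set_scope.
Local Open Scope ring_scope.

(** * The Gaussian Poincare inequality in dimension one *)

(** The square roots in the statement reflect the scale of the deviation. If Z is at distance at
    least l from tf, the fluctuation at the radius at distance l is at least l^2, while its second
    moment is of order sigma^2 tf^2 for l small against tf. The probability is then of order sigma^2
    tf^2 / l^4, so the natural l is sqrt (sigma tf), and a shift of that size moves sqrt tf by a
    multiple of sqrt sigma that no longer involves tf. The intermediate radius s has to be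
    deterministic, because the variance bound holds at fixed radii; s = Z would call for control
    uniform in the radius.

    The one-dimensional inequality is centred at the value at 0 and not at the mean. Efron-Stein
    tolerates this: the conditional variance in a coordinate is at most the mean squared distance to
    any function that ignores this coordinate. In exchange, the one-dimensional proof reduces to a
    pointwise Cauchy-Schwarz bound and one integration by parts. *)

Section density.
Context d (T : measurableType d) (R : realType).
Variables (mu nu : {measure set T -> \bar R}) (p : T -> R).
Hypotheses (mp : measurable_fun [set: T] p) (p_ge0 : forall x, 0 <= p x).
Hypothesis nuE : forall A, measurable A -> nu A = (\int[mu]_(x in A) (p x)%:E)%E.

Import HBNNSimple.

Let integral_density_nnsfun (f : {nnsfun T >-> R}) :
  (\int[nu]_x (f x)%:E = \int[mu]_x (f x * p x)%:E)%E.
Proof.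
under [LHS]eq_integral do rewrite fimfunE -fsumEFin//.
rewrite [LHS]ge0_integral_fsum//; last 2 first.
  - by move=> r; exact/measurable_EFinP/measurableT_comp.
  - by move=> n x _; rewrite EFinM nnfun_muleindic_ge0.
under [RHS]eq_integral.
  move=> x xD; rewrite EFinM fimfunE -fsumEFin// muleC ge0_mule_fsumr; last first.
    by move=> r; have := nnfun_muleindic_ge0 f r x; rewrite -EFinM.
  over.
rewrite [RHS]ge0_integral_fsum//; last 2 first.
  - move=> r; apply: emeasurable_funM; first exact/measurable_EFinP.
    by apply/measurable_EFinP/measurableT_comp => //; exact: measurable_funM.
  - move=> n x _; rewrite mule_ge0 ?lee_fin//.
    by have := nnfun_muleindic_ge0 f n x; rewrite -EFinM.
apply: eq_fsbigr => r _.
rewrite integralZl_indic_nnsfun//= integral_indic//= setIT nuE//.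
have [r0|r0] := ltP r 0.
  have -> : f @^-1` [set r] = set0.
    exact: preimage_nnfun0.
  rewrite integral_set0 mule0.
  by under eq_integral do rewrite indicE in_set0 mulr0 mule0; rewrite integral0.
rewrite (@integral_mkcond _ _ _ _ (f @^-1` [set r])) -ge0_integralZl//; last 2 first.
- apply/(measurable_restrictT _ _).1 => //.
  exact/measurable_EFinP/measurable_funTS.
- by move=> x _; rewrite patchE; case: ifP; rewrite ?lee_fin.
apply: eq_integral => x _; rewrite patchE indicE.
by case: ifP; rewrite ?mulr1 ?mulr0 ?mule0// muleC.
Qed.

(** Linearity carries the hypothesis on sets to simple functions, and monotone convergence carries
    it on to nonnegative measurable functions. *)
Lemma ge0_integral_density (f : T -> \bar R) :
  measurable_fun [set: T] f -> (forall x, 0 <= f x)%E ->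
  (\int[nu]_x f x = \int[mu]_x (f x * (p x)%:E))%E.
Proof.
move=> mf f0.
pose f_ := nnsfun_approx measurableT mf.
transitivity (lim (\int[nu]_x (f_ n x)%:E @[n --> \oo])%E).
  rewrite -monotone_convergence//=.
  - apply: eq_integral => ? /[!inE] xD; apply/esym/cvg_lim => //=.
    exact: cvg_nnsfun_approx.
  - by move=> n; exact/measurable_EFinP/measurable_funTS.
  - by move=> n ? _; rewrite lee_fin.
  - by move=> ? _ ? ? mn; rewrite lee_fin; exact/lefP/nd_nnsfun_approx.
transitivity (lim (\int[mu]_x (f_ n x * p x)%:E @[n --> \oo])%E).
  by apply: congr_lim; apply/funext => n; exact: integral_density_nnsfun.
rewrite -monotone_convergence//=.
- apply: eq_integral => x _; apply/cvg_lim => //=.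
  under eq_fun do rewrite EFinM.
  by apply: cvgeZr => //; exact: cvg_nnsfun_approx.
- by move=> n; apply/measurable_EFinP/measurable_funM.
- by move=> n ? _; rewrite lee_fin mulr_ge0.
- move=> x _ ? ? mn; rewrite lee_fin ler_wpM2r//.
  exact/lefP/nd_nnsfun_approx.
Qed.

End density.

(** * Calculus of the normal density *)

Section normal_calculus.
Context {R : realType}.
Implicit Types (s x : R) (f g : R -> R).

Lemma continuous_is_derive f g : (forall y : R, is_derive y 1 f (g y)) ->
  continuous f.
Proof.
move=> fg x; apply/differentiable_continuous/derivable1_diffP.
exact: (@ex_derive _ _ _ _ _ _ _ (fg x)).
Qed.

(** The relation x phi = - s^2 phi' is the source of the factor s^2 in the Poincare inequality. *)
Lemma is_derive_normal_pdf s x : s != 0 ->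
  is_derive x 1 (normal_pdf 0 s) (- (x / s ^+ 2) * normal_pdf 0 s x).
Proof.
move=> s0; rewrite normal_pdfE// /normal_fun.
have -> : (fun y => normal_peak s * expR (- (y - 0) ^+ 2 / (s ^+ 2 *+ 2))) =
  (normal_peak s *: (expR \o (- (s ^+ 2 *+ 2)^-1 *: (@GRing.exp R ^~ 2)))).
  apply/funext => y; rewrite subr0 -[RHS]/(_ * expR (- (s ^+ 2 *+ 2)^-1 * y ^+ 2)).
  by congr (_ * expR _); rewrite mulrC mulrN mulNr.
apply: is_derive_eq.
rewrite /GRing.scale /= subr0; set E := expR _; set E' := expR _.
have -> : E = E' by rewrite /E /E'; congr expR; rewrite [LHS]mulNr [RHS]mulNr [in LHS]mulrC.
rewrite -mulr_natr; field.
by rewrite s0.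
Qed.

Lemma integral_normal_prob s (f : R -> \bar R) :
  measurable_fun [set: R] f -> (forall x, 0 <= f x)%E ->
  (\int[normal_prob 0 s]_x f x =
   \int[lebesgue_measure]_x (f x * (normal_pdf 0 s x)%:E))%E.
Proof.
move=> mf f0; apply: ge0_integral_density => //.
- exact: measurable_normal_pdf.
- by move=> x; exact: normal_pdf_ge0.
Qed.

(* Cauchy-Schwarz for f x - f 0 = int_0^x f', in the form "the discriminant of
   int_0^x (f' - c)^2 >= 0 is nonpositive". *)
Lemma sqr_increment_le (f g H : R -> R) (x l u : R) : l < 0 < u -> l < x < u ->
  (forall y : R, is_derive y 1 f (g y)) ->
  (forall y : R, l < y < u -> is_derive y 1 H (g y ^+ 2)) -> H 0 = 0 ->
  (f x - f 0) ^+ 2 <= x * H x.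
Proof.
move=> /andP[l0 u0] /andP[lx xu] dfg dH H0.
have [->|x0] := eqVneq x 0; first by rewrite subrr expr0n/= mul0r.
(* For this mean slope, [x * (K x - K 0)] equals [x * H x] minus the square of [f x - f 0]; it is
   nonnegative for either sign of x, since K' is a square. *)
pose c := (f x - f 0) / x.
pose K y := H y - (2 * c) *: f y + c ^+ 2 *: y.
pose K' y := (g y - c) ^+ 2.
have dK y : l < y < u -> is_derive y 1 K (K' y).
  move=> ly; apply: (is_derive_eq (is_deriveD (is_deriveB (dH y ly)
    (is_deriveZ (2 * c) (dfg y))) (is_deriveZ (c ^+ 2) (is_derive_id y 1)))).
  by rewrite /K' /GRing.scale /=; ring.
have cK a b : l < a -> b < u -> {within `[a, b], continuous K}.
  move=> la bu; apply: derivable_within_continuous => z.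
  rewrite in_itv/= => /andP[az zb].
  by apply: (@ex_derive _ _ _ _ _ _ _ (dK z _)); rewrite (lt_le_trans la az) (le_lt_trans zb bu).
have fx : f x = c * x + f 0 by rewrite /c divfK// subrK.
have -> : x * H x = x * (K x - K 0) + (f x - f 0) ^+ 2.
  by rewrite /K /GRing.scale /= H0 fx; ring.
rewrite lerDr.
have [xp|xn|xe] := ltgtP 0 x; last by rewrite xe eqxx in x0.
- have dKx z : z \in `]0, x[ -> is_derive z 1 K (K' z).
    rewrite in_itv/= => /andP[z0 zx].
    by apply: dK; rewrite (lt_trans l0 z0) (lt_trans zx xu).
  have [z _ ->] := MVT xp dKx (cK _ _ l0 xu).
  by rewrite subr0 mulrCA mulr_ge0 ?sqr_ge0// -expr2 sqr_ge0.
- have dKx z : z \in `]x, 0[ -> is_derive z 1 K (K' z).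
    rewrite in_itv/= => /andP[z0 zx].
    by apply: dK; rewrite (lt_trans lx z0) (lt_trans zx u0).
  have [z _ e] := MVT xn dKx (cK _ _ lx u0).
  have -> : x * (K x - K 0) = - x * (K 0 - K x) by ring.
  by rewrite e sub0r mulrCA mulr_ge0 ?sqr_ge0// -expr2 sqr_ge0.
Qed.

End normal_calculus.

Section poincare_normal.
Context {R : realType}.
Variables (s : R) (f g : R -> R).
Hypotheses (s_gt0 : 0 < s) (dfg : forall x : R, is_derive x 1 f (g x))
  (cg : continuous g).

Let mu := @lebesgue_measure R.
Let phi := normal_pdf 0 s.

Let s_neq0 : s != 0. Proof. by rewrite gt_eqF. Qed.

Let cphi : continuous phi. Proof. exact: continuous_normal_pdf. Qed.

Let cf : continuous f. Proof. exact: continuous_is_derive dfg. Qed.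

Let cg2 : continuous (fun x => g x ^+ 2).
Proof. by move=> x; apply: cvgM; exact: cg. Qed.

Let cintegrable (u : R -> R) a b : {within `[a, b], continuous u} ->
  mu.-integrable `[a, b] (EFin \o u).
Proof. by move=> cu; apply: continuous_compact_integrable => //; exact: segment_compact. Qed.

(* Stein's identity on [-M, M]: the derivative of - s^2 phi H is
   x phi H - s^2 phi H', and the boundary terms have the right sign because H
   is nondecreasing and vanishes at 0. *)
Let poincare_itv (M : R) : 0 < M ->
  (\int[mu]_(x in `[(- M)%R, M]) ((f x - f 0) ^+ 2 * phi x)%:E <=
   \int[mu]_(x in `[(- M)%R, M]) (s ^+ 2 * g x ^+ 2 * phi x)%:E)%E.
Proof.
(* The margin of 1 makes H and K differentiable at the end points -M and M too. *)
move=> M0; pose l := - (M + 1); pose u := M + 1.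
have lu : l < u by rewrite /l /u; lra.
pose G x := (\int[mu]_(t in [set` `[l, x]]) (g t ^+ 2))%R.
pose H x := G x - G 0.
have dG x : l < x < u -> is_derive x 1 G (g x ^+ 2).
  move=> /andP[lx xu].
  have [dG GE] := @continuous_FTC1_closed _ (fun t => g t ^+ 2) l x u xu
    (cintegrable (continuous_subspaceT cg2)) lx (@cg2 x).
  by apply: DeriveDef; [exact: dG|rewrite -derive1E GE].
have dH x : l < x < u -> is_derive x 1 H (g x ^+ 2).
  move=> lxu; have dGx := dG x lxu; rewrite /H.
  apply: (is_derive_eq (is_deriveB dGx (is_derive_cst (G 0) x 1))).
  by rewrite subr0.
have H0 : H 0 = 0 by rewrite /H subrr.
pose K (x : R) : R := - s ^+ 2 * (phi x * H x).
pose k (x : R) : R := x * H x * phi x - s ^+ 2 * g x ^+ 2 * phi x.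
have dK x : l < x < u -> is_derive x 1 K (k x).
  move=> lxu; have dHx := dH x lxu; have dphi := is_derive_normal_pdf x s_neq0.
  apply: (is_derive_eq (is_deriveZ (- s ^+ 2) (is_deriveM dphi dHx))).
  rewrite /k /GRing.scale /= -/phi.
  by field.
have sub x : x \in `[- M, M] -> l < x < u.
  by rewrite in_itv/= => /andP[? ?]; rewrite /l /u; apply/andP; split; lra.
have subo x : x \in `]- M, M[ -> l < x < u.
  by move=> xM; apply: sub; exact: subset_itv_oo_cc.
have cH : {within `[- M, M], continuous H}.
  apply: derivable_within_continuous => z /sub zM.
  by apply: (@ex_derive _ _ _ _ _ _ _ (dH z zM)).
have cK : {within `[- M, M], continuous K}.
  apply: derivable_within_continuous => z /sub zM.
  by apply: (@ex_derive _ _ _ _ _ _ _ (dK z zM)).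
have c1 : {within `[- M, M], continuous (fun x => x * H x * phi x)}.
  move=> x; apply: cvgM; [apply: cvgM => //|]; last exact: continuous_subspaceT.
    exact: (continuous_subspaceT (fun x => cvg_id)).
  exact: cH.
have c2 : {within `[- M, M], continuous (fun x => s ^+ 2 * g x ^+ 2 * phi x)}.
  apply: continuous_subspaceT => x; apply: cvgM; [apply: cvgM => //|exact: cphi].
    exact: cvg_cst.
  exact: cg2.
have ck : {within `[- M, M], continuous k}.
  by move=> x; apply: cvgB; [exact: c1|exact: c2].
have MM : - M < M by lra.
have MMle : -M <= M by lra.
have := @continuous_FTC2 _ k K (- M) M MM ck.
have LR : derivable_oo_LRcontinuous K (- M) M.
  have [_ KM KM'] := (continuous_within_itvP K MM).1 cK.
  split => //.
  by move=> x xM; apply: (@ex_derive _ _ _ _ _ _ _ (dK x (subo _ xM))).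
move=> /(_ LR); have dKk : {in `]- M, M[, K^`()%classic =1 k}.
  move=> x /subo xM; rewrite derive1E; have dKx := dK x xM; exact: derive_val.
move=> /(_ dKk) intk.
(* Both signs follow from 0 <= (f x - f 0)^2 <= x H x at x = M and x = -M. *)
have HM : 0 <= H M /\ H (- M) <= 0.
  have H1 := @sqr_increment_le _ f g H M l u.
  have H2 := @sqr_increment_le _ f g H (- M) l u.
  have l0u : l < 0 < u by rewrite /l /u; apply/andP; split; lra.
  split.
    rewrite -(pmulr_rge0 _ M0); apply: le_trans (H1 l0u _ dfg dH H0); first exact: sqr_ge0.
    by apply: sub; rewrite in_itv/= MMle lexx.
  rewrite -oppr_ge0 -(pmulr_rge0 _ M0) mulrN -mulNr.
  apply: le_trans (H2 l0u _ dfg dH H0); first exact: sqr_ge0.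
  by apply: sub; rewrite in_itv/= MMle lexx.
have Kle : K M - K (- M) <= 0.
  have p1 : 0 <= phi M := normal_pdf_ge0 _ _ _.
  have p2 : 0 <= phi (- M) := normal_pdf_ge0 _ _ _.
  rewrite /K !mulNr opprK addrC subr_le0.
  apply: ler_wpM2l; first exact: sqr_ge0.
  by case: HM => h1 h2; apply: (@le_trans _ _ 0); rewrite ?mulr_ge0// mulr_ge0_le0.
apply: (@le_trans _ _ (\int[mu]_(x in `[(- M)%R, M]) (x * H x * phi x)%:E)%E).
  apply: ge0_le_integral => //.
  - by move=> x _; rewrite lee_fin mulr_ge0 ?sqr_ge0// normal_pdf_ge0.
  - by apply: (measurable_int mu); apply: cintegrable; apply: continuous_subspaceT => x;
      apply: cvgM; [apply: cvgM; apply: cvgB; (exact: cf || exact: cvg_cst)|exact: cphi].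
  - by apply: (measurable_int mu); exact: cintegrable c1.
  - move=> x /sub xM; rewrite lee_fin ler_wpM2r ?normal_pdf_ge0//.
    apply: (@sqr_increment_le _ f g H x l u) => //.
    by rewrite /l /u; apply/andP; split; lra.
have i1 := cintegrable c1; have i2 := cintegrable c2.
move: intk; rewrite /k; under eq_integral do rewrite EFinB.
rewrite integralB_EFin//.
rewrite -(fineK (integrable_fin_num _ i1))// -(fineK (integrable_fin_num _ i2))//.
by rewrite -!EFinB => -[e]; rewrite lee_fin -subr_le0 e.
Qed.

(** Monotone convergence along the intervals [-M, M]. Either side may be infinite. *)
Lemma poincare_normal1 :
  (\int[normal_prob 0 s]_x ((f x - f 0) ^+ 2)%:E <=
   \int[normal_prob 0 s]_x (s ^+ 2 * g x ^+ 2)%:E)%E.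
Proof.
have mf0 : measurable_fun [set: R] (fun x => (f x - f 0) ^+ 2).
  by apply: continuous_measurable_fun => x; apply: cvgM; apply: cvgB;
    (exact: cf || exact: cvg_cst).
have mg2 : measurable_fun [set: R] (fun x => s ^+ 2 * g x ^+ 2).
  apply: continuous_measurable_fun => x; apply: cvgM; first exact: cvg_cst.
  exact: cg2.
have mphi : measurable_fun [set: R] phi by exact: measurable_normal_pdf.
rewrite !integral_normal_prob//; last 4 first.
- exact/measurable_EFinP.
- by move=> x; rewrite lee_fin mulr_ge0// sqr_ge0.
- exact/measurable_EFinP.
- by move=> x; rewrite lee_fin sqr_ge0.
pose F (i : nat) : set R := `[(- i.+1%:R)%R, i.+1%:R]%classic.
have cover : \bigcup_(i : nat) F i = [set: R].
  rewrite -subTset => x _; exists (Num.truncn `|x|) => //=.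
  rewrite /F/= in_itv/= -ler_norml ltW//.
  by have := truncnS_gt `|x|.
rewrite -cover.
have nd : nondecreasing_seq F.
  move=> i j ij; apply/subsetPset => x; rewrite /F/= !in_itv/= => /andP[h1 h2].
  have : i.+1%:R <= j.+1%:R :> R by rewrite ler_nat.
  by move=> h3; apply/andP; split; lra.
have cv := @ge0_nondecreasing_set_cvg_integral _ _ _ _ _ mu nd.
have mF i : measurable (F i) by exact: measurable_itv.
apply: cvge_le; last first.
  apply: cv => //.
  - by move=> i; apply: measurable_funTS; apply/measurable_EFinP; exact: measurable_funM.
  - by move=> i x _; rewrite lee_fin mulr_ge0 ?normal_pdf_ge0 ?sqr_ge0.
apply: nearW => i.
apply: (@le_trans _ _ (\int[mu]_(x in F i) ((s ^+ 2 * g x ^+ 2)%:E * (phi x)%:E))%E).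
  exact: poincare_itv.
rewrite cover; apply: ge0_subset_integral => //.
- exact: mF.
- by apply/measurable_EFinP; exact: measurable_funM.
- by move=> x _; rewrite -EFinM lee_fin mulr_ge0 ?normal_pdf_ge0// mulr_ge0// sqr_ge0.
- exact: eventually_filter.
Qed.

End poincare_normal.

(** * Vectors and resampling of coordinates *)

Section euclidean.
Context {R : realType} {n : nat}.
Implicit Types (u v x y : 'cV[R]_n) (f : 'cV[R]_n -> R) (L : R).

Definition dotv u v : R := \sum_(i < n) u i 0 * v i 0.

Lemma trmx_mul_dotv u v : (u^T *m v) 0 0 = dotv u v.
Proof. by rewrite mxE; apply: eq_bigr => i _; rewrite mxE. Qed.

Lemma dotvC u v : dotv u v = dotv v u.
Proof. by apply: eq_bigr => i _; rewrite mulrC. Qed.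

Lemma dotvDr u v y : dotv u (v + y) = dotv u v + dotv u y.
Proof. by rewrite -big_split; apply: eq_bigr => i _; rewrite mxE mulrDr. Qed.

Lemma dotvZr a u v : dotv u (a *: v) = a * dotv u v.
Proof. by rewrite mulr_sumr; apply: eq_bigr => i _; rewrite mxE mulrCA. Qed.

Lemma dotvNr u v : dotv u (- v) = - dotv u v.
Proof. by rewrite -scaleN1r dotvZr mulN1r. Qed.

Lemma dotvBr u v y : dotv u (v - y) = dotv u v - dotv u y.
Proof. by rewrite dotvDr dotvNr. Qed.

Lemma dotvDl u v y : dotv (v + y) u = dotv v u + dotv y u.
Proof. by rewrite !(dotvC _ u) dotvDr. Qed.

Lemma dotvBl u v y : dotv (v - y) u = dotv v u - dotv y u.
Proof. by rewrite !(dotvC _ u) dotvBr. Qed.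

Lemma dotvZl a u v : dotv (a *: v) u = a * dotv v u.
Proof. by rewrite !(dotvC _ u) dotvZr. Qed.

Lemma dotvv_ge0 u : 0 <= dotv u u.
Proof. by apply: sumr_ge0 => i _; rewrite -expr2 sqr_ge0. Qed.

Lemma l2norm_ge0 u : 0 <= l2norm u.
Proof. exact: sqrtr_ge0. Qed.

Lemma l2norm_sqr u : l2norm u ^+ 2 = dotv u u.
Proof.
rewrite sqr_sqrtr; last by apply: sumr_ge0 => i _; rewrite sqr_ge0.
by apply: eq_bigr => i _; rewrite expr2.
Qed.

Lemma ler_abs_l2norm u i : `|u i 0| <= l2norm u.
Proof.
rewrite -sqrtr_sqr ler_sqrt; last by apply: sumr_ge0 => j _; rewrite sqr_ge0.
by rewrite (bigD1 i)//= lerDl; apply: sumr_ge0 => j _; rewrite sqr_ge0.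
Qed.

Lemma l2norm0_eq0 u : l2norm u = 0 -> u = 0.
Proof.
move=> u0; apply/colP => i; rewrite mxE; apply/eqP; rewrite -normr_le0 -u0.
exact: ler_abs_l2norm.
Qed.

Lemma l2norm0 : l2norm (0 : 'cV[R]_n) = 0.
Proof.
by rewrite /l2norm big1 ?sqrtr0// => i _; rewrite mxE expr0n.
Qed.

(** Cauchy-Schwarz, from expanding the squared norm of |v| u - |u| v. *)
Lemma dotv_le u v : dotv u v <= l2norm u * l2norm v.
Proof.
have [u0|u0] := eqVneq (l2norm u) 0.
  by rewrite u0 mul0r (l2norm0_eq0 u0) /dotv big1// => i _; rewrite mxE mul0r.
have [v0|v0] := eqVneq (l2norm v) 0.
  by rewrite v0 mulr0 (l2norm0_eq0 v0) /dotv big1// => i _; rewrite mxE mulr0.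
have u_gt0 : 0 < l2norm u by rewrite lt0r u0 l2norm_ge0.
have v_gt0 : 0 < l2norm v by rewrite lt0r v0 l2norm_ge0.
have := dotvv_ge0 (l2norm v *: u - l2norm u *: v).
rewrite dotvBl !dotvBr !dotvZl !dotvZr -!l2norm_sqr (dotvC v u).
set a := l2norm u in u_gt0 *; set b := l2norm v in v_gt0 *; set c := dotv u v.
have -> : b * (b * a ^+ 2) - b * (a * c) - (a * (b * c) - a * (a * b ^+ 2)) =
  2 * (a * b) * (a * b - c) by ring.
by rewrite pmulr_rge0 ?subr_ge0// !mulr_gt0.
Qed.

Lemma l2normD u v : l2norm (u + v) <= l2norm u + l2norm v.
Proof.
rewrite -(@ler_pXn2r _ 2)// ?nnegrE ?addr_ge0 ?l2norm_ge0//.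
rewrite sqrrD !l2norm_sqr dotvDl !dotvDr (dotvC v u).
have := dotv_le u v; lra.
Qed.

Lemma l2normN u : l2norm (- u) = l2norm u.
Proof. by congr Num.sqrt; apply: eq_bigr => i _; rewrite mxE sqrrN. Qed.

Lemma l2normB u v : l2norm (u - v) = l2norm (v - u).
Proof. by rewrite -l2normN opprB. Qed.

Lemma l2normZ a u : l2norm (a *: u) = `|a| * l2norm u.
Proof.
apply/eqP; rewrite -(@eqrXn2 _ 2)// ?mulr_ge0 ?l2norm_ge0//.
by rewrite exprMn real_normK ?num_real// !l2norm_sqr dotvZl dotvZr mulrA -expr2.
Qed.

Lemma l2norm_le_sum u : l2norm u <= \sum_(i < n) `|u i 0|.
Proof.
have S0 : 0 <= \sum_(i < n) `|u i 0| by exact: sumr_ge0.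
rewrite -(@ler_pXn2r _ 2)// ?nnegrE ?l2norm_ge0// l2norm_sqr.
rewrite [leRHS]expr2 mulr_suml; apply: ler_sum => i _.
rewrite -expr2 -real_normK ?num_real// expr2 ler_wpM2l// (bigD1 i)//= lerDl.
exact: sumr_ge0.
Qed.

(* Stated one-sidedly; the other bound follows by exchanging x and y. *)
Definition lipv L f := forall x y, f x <= f y + L * l2norm (x - y).

Lemma lipv_norm L f x y : lipv L f -> `|f x - f y| <= L * l2norm (x - y).
Proof.
move=> Lf; rewrite ler_norml lerNl opprB.
have := Lf x y; have := Lf y x; rewrite l2normB => h1 h2.
by apply/andP; split; lra.
Qed.

Definition updv x (i : 'I_n) (z : R) : 'cV[R]_n :=
  \col_j (if j == i then z else x j 0).

Lemma updv_id x i z z' : updv (updv x i z) i z' = updv x i z'.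
Proof. by apply/colP => j; rewrite !mxE; case: eqP. Qed.

Lemma updvC x i j z z' : i != j ->
  updv (updv x i z) j z' = updv (updv x j z') i z.
Proof.
move=> ij; apply/colP => k; rewrite !mxE.
by case: (eqVneq k j) => // ->; rewrite eq_sym (negbTE ij).
Qed.

Lemma l2norm_updv x y i z :
  l2norm (updv x i z - updv y i z) <= l2norm (x - y).
Proof.
rewrite ler_sqrt; last by apply: sumr_ge0 => j _; rewrite sqr_ge0.
apply: ler_sum => j _; rewrite !mxE; case: eqP => // _.
by rewrite subrr expr0n sqr_ge0.
Qed.

Lemma l2norm_updv_same x i z z' :
  l2norm (updv x i z - updv x i z') = `|z - z'|.
Proof.
rewrite /l2norm (bigD1 i)//= big1 ?addr0.
  by rewrite !mxE eqxx sqrtr_sqr.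
by move=> j ji; rewrite !mxE (negbTE ji) subrr expr0n.
Qed.

Lemma rational_dense_l2norm x (e : R) : 0 < e ->
  exists q : 'cV[rat]_n, l2norm (x - map_mx ratr q) < e.
Proof.
(* Dividing by [n.+1] keeps d positive for n = 0 and makes the sum of n copies of d strictly less
   than e. *)
move=> e0; pose d := e / n.+1%:R.
have d0 : 0 < d by rewrite divr_gt0.
have H i : exists q : rat, `|x i 0 - ratr q| < d.
  have [q] := @rat_in_itvoo R (x i 0 - d) (x i 0 + d) ltac:(lra).
  rewrite in_itv/= => /andP[q1 q2]; exists q; rewrite ltr_norml.
  by apply/andP; split; lra.
exists (\col_i sval (cid (H i))).
apply: le_lt_trans (l2norm_le_sum _) _.
apply: (@le_lt_trans _ _ (\sum_(i < n) d)).
  by apply: ler_sum => i _; rewrite !mxE; case: cid => q /= /ltW.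
rewrite sumr_const card_ord -mulr_natr /d -mulrA gtr_pMr// mulrC.
by rewrite ltr_pdivrMr// mul1r ltr_nat.
Qed.

End euclidean.

(** * Measurability of Lipschitz functions of a vector *)

Section box_sigma_algebra.
Context {R : realType} {n : nat}.

(** Generators of the product sigma-algebra on column vectors, and exactly the sets on which
    [gaussian_noise] prescribes the law. *)
Definition boxes : set (set 'cV[R]_n) :=
  [set A | exists2 B : 'I_n -> set R, (forall i, measurable (B i)) &
     A = [set x : 'cV[R]_n | forall i, B i (x i 0)]].

Local Notation cvM := (g_sigma_algebraType boxes).

Lemma measurable_to_cvM d (T : measurableType d) (phi : T -> 'cV[R]_n) :
  (forall i, measurable_fun [set: T] (fun t => phi t i 0)) ->
  measurable_fun [set: T] (phi : T -> cvM).
Proof.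
move=> mphi; apply: (@measurability _ _ T cvM setT phi boxes erefl).
move=> _ [_ [B mB ->] <-]; rewrite setTI.
have -> : phi @^-1` [set x : 'cV[R]_n | forall i, B i (x i 0)] =
    \big[setI/setT]_(i < n) ((fun t => phi t i 0) @^-1` B i).
  rewrite -bigcap_seq; apply/seteqP; split => t /=.
    by move=> Bt i /= _; exact: Bt.
  by move=> Bt i; apply: Bt; rewrite /= mem_index_enum.
by apply: bigsetI_measurable => i _; rewrite -[X in measurable X]setTI; exact: mphi.
Qed.

Lemma measurable_coord i : measurable_fun [set: cvM] (fun x : 'cV[R]_n => x i 0).
Proof.
move=> _ B mB; rewrite setTI; apply: sub_sigma_algebra.
exists (fun j => if j == i then B else setT).
  by move=> j; case: ifP.
apply/seteqP; split => x /= Bx; last by have := Bx i; rewrite eqxx.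
by move=> j; case: ifPn => // /eqP ->.
Qed.

(** By the Lipschitz bound and density, f x is the infimum over rational vectors q of f q + L |x -
    q|_1, so each strict sublevel set is a countable union. The l1 norm is used because its
    measurability is visible from the coordinates. *)
Lemma measurable_lipv (L : R) (f : 'cV[R]_n -> R) : 0 <= L -> lipv L f ->
  measurable_fun [set: cvM] f.
Proof.
move=> L0 Lf; apply: (@measurability _ _ cvM _ setT f _ (@RGenInftyO.measurableE R)).
move=> _ [_ [a ->] <-]; rewrite setTI.
pose l1 (x : 'cV[R]_n) : R := \sum_(i < n) `|x i 0|.
pose Q (q : 'cV[rat]_n) : 'cV[R]_n := map_mx ratr q.
pose D q := [set x : cvM | f (Q q) + L * l1 (x - Q q) < a].
have -> : f @^-1` `]-oo, a[ = \bigcup_k (if unpickle k is Some q then D q else set0).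
  apply/seteqP; split => x /=.
    rewrite in_itv/= => fxa.
    (* For r the distance from x to q, passing from f x to f q costs at most L r and the l1 term at
       most L n.+1 r, together at most 2 L n.+1 r. The added 1 keeps the quotient below defined when
       L = 0. *)
    have L1 : 0 < L * n.+1%:R * 2 + 1.
      by rewrite ltr_wpDl// !mulr_ge0.
    have e0 : 0 < (a - f x) / (L * n.+1%:R * 2 + 1).
      by rewrite divr_gt0// subr_gt0.
    have [q xq] := rational_dense_l2norm x e0.
    exists (pickle q) => //; rewrite pickleK /D/=.
    have l1xq : l1 (x - Q q) <= n.+1%:R * l2norm (x - Q q).
      apply: (@le_trans _ _ (\sum_(i < n) l2norm (x - Q q))).
        by apply: ler_sum => i _; exact: ler_abs_l2norm.
      rewrite sumr_const card_ord -[leLHS]mulr_natl ler_wpM2r ?l2norm_ge0//.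
      by rewrite ler_nat.
    have := Lf (Q q) x; rewrite l2normB -/(Q q) => fq.
    have n1 : 1 <= n.+1%:R :> R by rewrite ler1n.
    set r := l2norm _ in xq l1xq fq.
    have r0 : 0 <= r by exact: l2norm_ge0.
    move: xq; rewrite -/r ltr_pdivlMr// => rlt.
    have h1 : L * l1 (x - Q q) <= L * (n.+1%:R * r) by exact: ler_wpM2l.
    have h2 : L * r <= L * (n.+1%:R * r).
      by apply: ler_wpM2l => //; rewrite ler_peMl.
    nra.
  move=> [k _]; case: unpickle => // q; rewrite /D/= in_itv/=.
  apply: le_lt_trans; apply: le_trans (Lf x (Q q)) _.
  by rewrite lerD2l ler_wpM2l// l2norm_le_sum.
apply: bigcupT_measurable => k; case: unpickle => // q.
have mD : measurable_fun [set: cvM] (fun x => f (Q q) + L * l1 (x - Q q)).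
  apply: measurable_funD => //; apply: measurable_funM => //.
  apply: measurable_sum => i; apply: measurableT_comp => //.
  under eq_fun do rewrite mxE.
  by apply: measurable_funD => //; exact: measurable_coord.
rewrite (_ : D q = (fun x => f (Q q) + L * l1 (x - Q q)) @^-1` `]-oo, a[%classic).
  rewrite -[X in measurable X]setTI.
  by apply: mD => //; exact: measurable_itv.
by apply/seteqP; split => x; rewrite /D/= in_itv.
Qed.

Lemma measurable_updv d (T : measurableType d) (phi : T -> 'cV[R]_n) (i : 'I_n)
    (z : T -> R) :
  (forall i, measurable_fun [set: T] (fun t => phi t i 0)) ->
  measurable_fun [set: T] z ->
  measurable_fun [set: T] (fun t => updv (phi t) i (z t) : cvM).
Proof.
move=> mphi mz; apply: measurable_to_cvM => j.
under eq_fun do rewrite mxE.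
by case: eqP => // _; exact: mphi.
Qed.

End box_sigma_algebra.

Local Notation cvM := (g_sigma_algebraType boxes).

(** * Invariance of the noise law under redrawing one coordinate *)

Section resampling.
Context {R : realType} {d : measure_display} {Omega : measurableType d}.
Variables (P : probability Omega R) (n : nat) (s : R) (eps : Omega -> 'cV[R]_n).
Hypothesis eps_gauss : gaussian_noise P s eps.

Local Notation N := (normal_prob (0 : R) s).

Definition resample (i : 'I_n) (wz : Omega * R) : 'cV[R]_n :=
  updv (eps wz.1) i wz.2.

Lemma measurable_noise : measurable_fun [set: Omega] (eps : Omega -> cvM).
Proof. by apply: measurable_to_cvM; case: eps_gauss. Qed.

Lemma measurable_resample i :
  measurable_fun [set: Omega * R] (resample i : Omega * R -> cvM).
Proof.
apply: measurable_updv => // j.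
apply: (@measurableT_comp _ _ _ _ _ _ (fun w => eps w j 0)) => //.
by case: eps_gauss.
Qed.

Let noise_law : {measure set cvM -> \bar R} :=
  measure_function_pushforward__canonical__measure_function_Measure
    P measurable_noise.

Let resample_law i : {measure set cvM -> \bar R} :=
  measure_function_pushforward__canonical__measure_function_Measure
    (P \x N)%E (measurable_resample i).

(** Independence of the coordinates enters here: the two laws agree on boxes, which are stable under
    intersection and generate the sigma-algebra. *)
Let noise_lawE i (A : set cvM) : measurable A -> noise_law A = resample_law i A.
Proof.
move=> mA.
have mB C : (forall j, measurable (C j)) ->
    measurable [set w | forall j, C j (eps w j 0)].
  move=> mC.
  have : measurable ([set x : 'cV[R]_n | forall j, C j (x j 0)] : set cvM).
    by apply: sub_sigma_algebra; exists C.
  by move/measurable_noise => /(_ measurableT); rewrite setTI.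
apply: (@measure_unique _ R cvM boxes (fun=> setT) _ _ _ _ noise_law (resample_law i)) => //.
- move=> _ _ [B1 mB1 ->] [B2 mB2 ->].
  exists (fun j => B1 j `&` B2 j); first by move=> j; exact: measurableI.
  apply/seteqP; split=> x /=; first by move=> [h1 h2] j.
  by move=> h; split=> j; case: (h j).
- by move=> _; exists (fun=> setT) => //; apply/seteqP; split.
- by rewrite bigcup_const//; exists 0%N.
- move=> _ [B mBj ->].
  have [_ eps_box] := eps_gauss.
  rewrite /= /pushforward.
  (* The old value of coordinate i is overwritten, so B' leaves it free and the constraint B i
     passes to the second factor. *)
  pose B' (j : 'I_n) := if j == i then setT else B j.
  have mB' j : measurable (B' j) by rewrite /B'; case: ifP.
  transitivity (\prod_(j < n) N (B j))%E.
    by rewrite -eps_box.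
  have -> : resample i @^-1` [set x | forall j, B j (x j 0)] =
      [set w | forall j, B' j (eps w j 0)] `*` B i.
    apply/seteqP; split => -[w z]; rewrite /resample /B' /=.
      move=> h; split=> [j|]; last by have := h i; rewrite mxE eqxx.
      by have := h j; rewrite mxE; case: eqP.
    by move=> [h1 h2] j; have := h1 j; rewrite mxE; case: eqP => // ->.
  rewrite product_measure1E; [|exact: mB|exact: mBj].
  rewrite -[RHS]/(P [set w | forall j, B' j (eps w j 0%R)] * N (B i))%E.
  rewrite (eps_box B' mB') (bigD1 i)//= [in RHS](bigD1 i)//= /B' eqxx.
  rewrite [X in (X * _ * _)%E]probability_setT mul1e muleC; congr (_ * _)%E.
  by apply: eq_bigr => j /negbTE ->.
- by move=> _; rewrite /= /pushforward preimage_setT probability_setT ltry.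
Qed.

Lemma ge0_integral_resample i (f : cvM -> \bar R) :
  measurable_fun [set: cvM] f -> (forall x, 0 <= f x)%E ->
  (\int[P]_w f (eps w) = \int[P]_w \int[N]_z f (updv (eps w) i z))%E.
Proof.
move=> mf f0.
have mfr : measurable_fun [set: Omega * R] (f \o resample i).
  exact: measurableT_comp mf (measurable_resample i).
transitivity (\int[noise_law]_x f x)%E.
  by rewrite ge0_integral_pushforward//; exact: measurable_noise.
rewrite (eq_measure_integral (resample_law i)); last first.
  by move=> A mA _; exact: noise_lawE.
rewrite ge0_integral_pushforward//; last exact: measurable_resample.
by rewrite preimage_setT fubini_tonelli1 => [||x]; [|exact: mfr|exact: f0].
Qed.

Lemma integral_resample i (f : cvM -> \bar R) :
  measurable_fun [set: cvM] f -> P.-integrable [set: Omega] (f \o eps) ->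
  (\int[P]_w f (eps w) = \int[P]_w \int[N]_z f (updv (eps w) i z))%E.
Proof.
move=> mf intf.
have mfr : measurable_fun [set: Omega * R] (f \o resample i).
  exact: measurableT_comp mf (measurable_resample i).
have intfr : (P \x N)%E.-integrable [set: Omega * R] (f \o resample i).
  (* Integrability over the product is the nonnegative case applied to the absolute value. *)
  apply/integrable12ltyP => //.
  rewrite -(@ge0_integral_resample i (abse \o f)).
  - by case/integrableP: intf.
  - exact: measurableT_comp.
  - by move=> x; exact: abse_ge0.
transitivity (\int[noise_law]_x f x)%E.
  by rewrite integral_pushforward//; exact: measurable_noise.
rewrite (eq_measure_integral (resample_law i)); last first.
  by move=> A mA _; exact: noise_lawE.
rewrite integral_pushforward//; last exact: measurable_resample.
by rewrite preimage_setT -integral12_prod_meas1.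
Qed.

End resampling.

(** * Square-integrable functions on a probability space *)

Section square_integrable.
Context {d : measure_display} {T : measurableType d} {R : realType}.
Variable mu : probability T R.
Implicit Types u v : T -> R.

Definition sqr_integrable u := measurable_fun [set: T] u /\
  mu.-integrable [set: T] (EFin \o (fun x => u x ^+ 2)).

Lemma sqr_integrable_le u v : measurable_fun [set: T] u ->
  sqr_integrable v -> (forall x, `|u x| <= `|v x|) -> sqr_integrable u.
Proof.
move=> mu_ [mv iv] uv; split => //; apply: le_integrable iv => //.
  by apply/measurable_EFinP; exact: measurable_funX.
move=> x _ /=; rewrite lee_fin !normrX.
by apply: lerXn2r; rewrite ?nnegrE.
Qed.

Lemma sqr_integrable_cst c : sqr_integrable (fun=> c).
Proof. by split => //; exact: finite_measure_integrable_cst. Qed.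

Lemma sqr_integrableM u v : sqr_integrable u -> sqr_integrable v ->
  mu.-integrable [set: T] (EFin \o (fun x => u x * v x)).
Proof.
move=> [mu_ iu] [mv iv].
have iuv := integrableD measurableT iu iv.
apply: le_integrable iuv => //.
  by apply/measurable_EFinP; exact: measurable_funM.
move=> x _ /=; rewrite lee_fin (@ger0_norm _ (u x ^+ 2 + _)) ?addr_ge0 ?sqr_ge0//.
rewrite normrM -[u x ^+ 2]real_normK ?num_real// -[v x ^+ 2]real_normK ?num_real//.
by nra.
Qed.

Lemma sqr_integrable_integrable u : sqr_integrable u ->
  mu.-integrable [set: T] (EFin \o u).
Proof.
move=> iu; have := sqr_integrableM iu (sqr_integrable_cst 1).
by apply: eq_integrable => // x _ /=; rewrite mulr1.
Qed.

Lemma sqr_integrableZ c u : sqr_integrable u -> sqr_integrable (fun x => c * u x).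
Proof.
move=> [mu_ iu]; split; first exact: measurable_funM.
have := integrableZl measurableT (c ^+ 2) iu.
by apply: eq_integrable => // x _ /=; rewrite -EFinM exprMn.
Qed.

Lemma sqr_integrableD u v : sqr_integrable u -> sqr_integrable v ->
  sqr_integrable (fun x => u x + v x).
Proof.
move=> iu iv; have [mu_ iu2] := iu; have [mv iv2] := iv.
split; first exact: measurable_funD.
have i2uv := integrableZl measurableT 2 (sqr_integrableM iu iv).
have := integrableD measurableT (integrableD measurableT iu2 iv2) i2uv.
apply: eq_integrable => // x _ /=.
by rewrite -EFinM -!EFinD; congr (_%:E); ring.
Qed.

Lemma sqr_integrableB u v : sqr_integrable u -> sqr_integrable v ->
  sqr_integrable (fun x => u x - v x).
Proof.
move=> iu /(sqr_integrableZ (-1)) /(sqr_integrableD iu).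
by under eq_fun do rewrite mulN1r.
Qed.

Lemma Rintegral_sqrB u v : sqr_integrable u -> sqr_integrable v ->
  \int[mu]_x (u x - v x) ^+ 2 =
  \int[mu]_x u x ^+ 2 - 2 * \int[mu]_x (u x * v x) + \int[mu]_x v x ^+ 2.
Proof.
move=> iu iv; have iuv := sqr_integrableM iu iv.
have iuv2 : mu.-integrable [set: T] (EFin \o (fun x => 2 * (u x * v x))).
  exact: (integrableZl measurableT 2 iuv).
have iu2 := iu.2; have iv2 := iv.2.
have iB : mu.-integrable [set: T] (EFin \o (fun x => u x ^+ 2 - 2 * (u x * v x))).
  exact: (integrableB measurableT iu2 iuv2).
rewrite -RintegralZl// -RintegralB// -RintegralD//.
by apply: eq_Rintegral => x _; ring.
Qed.

Lemma probability_integral_cst (c : R) : (\int[mu]_x c%:E = c%:E)%E.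
Proof.
transitivity (c%:E * mu [set: T])%E; first exact: integral_cst.
by rewrite probability_setT mule1.
Qed.

Lemma probability_Rintegral_cst c : \int[mu]_x c = c.
Proof. by rewrite /Rintegral probability_integral_cst. Qed.

(** A is any event that forces Y to be at least r: in the application it is a tail event of the
    prediction error, not a level set of Y. *)
Lemma chebyshev_tail (A : set T) (Y : T -> R) (r b : R) : measurable A ->
  sqr_integrable Y -> 0 < r -> (forall w, A w -> r <= Y w) ->
  \int[mu]_w Y w ^+ 2 <= b -> (mu A <= (b / r ^+ 2)%:E)%E.
Proof.
move=> mA sY r0 AY Yv.
rewrite -(fineK (fin_num_measure mu A mA)) lee_fin ler_pdivlMr ?exprn_gt0//.
have iA := integrable_indic mu mA.
have -> : fine (mu A) = \int[mu]_w \1_A w by rewrite /Rintegral integral_indic// setIT.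
rewrite -RintegralZr//; apply: le_trans Yv; apply: le_Rintegral => //.
- exact: (integrableZr measurableT (r ^+ 2) iA).
- exact: sY.2.
move=> w _; rewrite indicE; have [/set_mem Aw|_] := boolP (w \in A); last first.
  by rewrite mul0r sqr_ge0.
by rewrite mul1r lerXn2r ?nnegrE ?(ltW r0) ?AY// (le_trans (ltW r0))// AY.
Qed.

End square_integrable.

Section normal_moments.
Context {R : realType}.
Variable s : R.
Hypothesis s_gt0 : 0 < s.

(** The Poincare inequality for the identity, whose value at 0 is 0 and whose derivative is 1. *)
Lemma integral_normal_sqr_le :
  (\int[normal_prob 0 s]_z (z ^+ 2)%:E <= (s ^+ 2)%:E)%E.
Proof.
have dg (x : R) : is_derive x 1 (@id R) (cst 1 x) by exact: is_derive_id.
have cg : continuous (cst 1 : R -> R) by exact: cst_continuous.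
have := @poincare_normal1 R s id (cst 1) s_gt0 dg cg.
under eq_integral do rewrite subr0.
move=> /le_trans; apply; rewrite /cst expr1n mulr1.
by rewrite probability_integral_cst.
Qed.

Lemma normal_sqr_integrable : sqr_integrable (normal_prob 0 s) (@id R).
Proof.
split; first exact: measurable_id.
apply/integrableP; split.
  by apply/measurable_EFinP; apply: measurable_funX; exact: measurable_id.
under eq_integral do rewrite /= ger0_norm ?sqr_ge0//.
by apply: le_lt_trans integral_normal_sqr_le _; rewrite ltry.
Qed.

End normal_moments.

(** * Conditional means and the Efron-Stein inequality *)

Section coordinate_mean.
Context {R : realType} {d : measure_display} {Omega : measurableType d}.
Variables (P : probability Omega R) (n : nat) (s : R) (eps : Omega -> 'cV[R]_n).
Hypotheses (s_gt0 : 0 < s) (eps_gauss : gaussian_noise P s eps).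
Implicit Types (f g h : 'cV[R]_n -> R) (i j : 'I_n).

Local Notation N := (normal_prob (0 : R) s).

(** The class in which the Efron-Stein argument runs: its members are measurable and square
    integrable under the noise, and averaging out a coordinate does not leave it. *)
Definition lipschitzv f := exists2 L, 0 <= L & lipv L f.

Lemma lipschitzv_measurable f : lipschitzv f -> measurable_fun [set: cvM] f.
Proof. by move=> [L L0 Lf]; exact: measurable_lipv L0 Lf. Qed.

Lemma lipschitzv_noise f : lipschitzv f -> measurable_fun [set: Omega] (f \o eps).
Proof.
move=> /lipschitzv_measurable mf.
exact: measurableT_comp mf (measurable_noise eps_gauss).
Qed.

Lemma lipschitzvB f g : lipschitzv f -> lipschitzv g ->
  lipschitzv (fun x => f x - g x).
Proof.
move=> [L L0 Lf] [M M0 Mg]; exists (L + M); first exact: addr_ge0.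
by move=> x y; have := Lf x y; have := Mg y x; rewrite (l2normB y) mulrDl; lra.
Qed.

Lemma coord_sqr_integrable i : sqr_integrable P (fun w => eps w i 0).
Proof.
have mi : measurable_fun [set: Omega] (fun w => eps w i 0).
  by case: eps_gauss.
split => //; apply/integrableP; split.
  by apply/measurable_EFinP; exact: measurable_funX.
have mi2 : measurable_fun [set: cvM] (fun x : cvM => ((x : 'cV[R]_n) i 0 ^+ 2)%:E).
  by apply/measurable_EFinP; apply: measurable_funX; exact: measurable_coord.
under eq_integral do rewrite /= ger0_norm ?sqr_ge0//.
have i0 (x : cvM) : (0 <= ((x : 'cV[R]_n) i 0%R ^+ 2)%:E)%E by rewrite lee_fin sqr_ge0.
rewrite (ge0_integral_resample eps_gauss i mi2 i0).
under eq_integral.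
  by move=> w _; under eq_integral do rewrite mxE eqxx; over.
apply: (@le_lt_trans _ _ (\int[P]_w (s ^+ 2)%:E)%E); last first.
  by rewrite probability_integral_cst ltry.
apply: ge0_le_integral => //.
- by move=> w _; apply: integral_ge0 => z _; rewrite lee_fin sqr_ge0.
- by move=> w _; exact: integral_normal_sqr_le.
Qed.

Lemma lipschitzv_sqr_integrable f : lipschitzv f -> sqr_integrable P (f \o eps).
Proof.
move=> Lf; have mf := lipschitzv_noise Lf; case: Lf => L L0 Lf.
have isum (r : seq 'I_n) :
    sqr_integrable P (fun w => \sum_(i <- r) `|eps w i 0|).
  elim: r => [|i r IH].
    by under eq_fun do rewrite big_nil; exact: sqr_integrable_cst.
  under eq_fun do rewrite big_cons.
  apply: sqr_integrableD => //; have [mi _] := coord_sqr_integrable i.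
  apply: sqr_integrable_le (coord_sqr_integrable i) _.
    exact: measurableT_comp.
  by move=> w; rewrite normr_id.
have iS := isum (index_enum 'I_n).
have := sqr_integrableD (sqr_integrable_cst P `|f 0|) (sqr_integrableZ L iS).
move=> H; apply: sqr_integrable_le H _; [exact: mf|move=> w].
have S0 : 0 <= \sum_(i < n) `|eps w i 0| by exact: sumr_ge0.
rewrite [leRHS]ger0_norm ?addr_ge0 ?mulr_ge0//=.
have := lipv_norm (eps w) 0 Lf; rewrite subr0 => h.
rewrite -[f (eps w)](subrK (f 0)) addrC; apply: le_trans (ler_normD _ _) _.
rewrite lerD2l; apply: le_trans h _.
by rewrite ler_wpM2l// l2norm_le_sum.
Qed.

Lemma lipschitzv_line_sqr_integrable f x i : lipschitzv f ->
  sqr_integrable N (fun z => f (updv x i z)).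
Proof.
move=> Lf.
have mf : measurable_fun [set: R] (fun z => f (updv x i z)).
  apply: (measurableT_comp (lipschitzv_measurable Lf)).
  by apply: (@measurable_updv _ _ _ _ (fun=> x)).
case: Lf => L L0 Lf.
have iz : sqr_integrable N (fun z : R => `|z|).
  apply: sqr_integrable_le (normal_sqr_integrable s_gt0) _.
    exact: measurableT_comp.
  by move=> z; rewrite normr_id.
have := sqr_integrableD (sqr_integrable_cst N `|f (updv x i 0)|) (sqr_integrableZ L iz).
move=> H; apply: sqr_integrable_le H _; [exact: mf|move=> z].
rewrite [leRHS]ger0_norm ?addr_ge0 ?mulr_ge0//=.
have := lipv_norm (updv x i z) (updv x i 0) Lf; rewrite l2norm_updv_same subr0 => h.
rewrite -[f (updv x i z)](subrK (f (updv x i 0))) addrC.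
by apply: le_trans (ler_normD _ _) _; rewrite lerD2l.
Qed.

Lemma Rintegral_resample i g : measurable_fun [set: cvM] g ->
  P.-integrable [set: Omega] (EFin \o (g \o eps)) ->
  (forall x, N.-integrable [set: R] (fun z => (g (updv x i z))%:E)) ->
  \int[P]_w g (eps w) = \int[P]_w \int[N]_z g (updv (eps w) i z).
Proof.
move=> mg ig igN; rewrite {1}/Rintegral.
have mg' : measurable_fun [set: cvM] (EFin \o g) by exact/measurable_EFinP.
rewrite (integral_resample eps_gauss i mg' ig).
congr fine; apply: eq_integral => w _ /=.
by rewrite -[LHS]fineK//; exact: integrable_fin_num.
Qed.

(** The conditional expectation given all coordinates but i, as an everywhere defined function. *)
Definition cmean i f (x : 'cV[R]_n) : R := \int[N]_z f (updv x i z).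

Lemma cmean_lipschitzv i f : lipschitzv f -> lipschitzv (cmean i f).
Proof.
move=> Lf; have If x := sqr_integrable_integrable (lipschitzv_line_sqr_integrable x i Lf).
case: Lf => L L0 Lf; exists L => // x y; rewrite /cmean.
have -> : \int[N]_z f (updv y i z) + L * l2norm (x - y) =
    \int[N]_z (f (updv y i z) + L * l2norm (x - y)).
  rewrite RintegralD ?probability_Rintegral_cst//.
  exact: finite_measure_integrable_cst.
apply: le_Rintegral => //.
  exact: (integrableD measurableT (If y) (finite_measure_integrable_cst _ _ _)).
move=> z _; apply: le_trans (Lf _ (updv y i z)) _.
by rewrite lerD2l ler_wpM2l// l2norm_updv.
Qed.

Lemma cmean_updv i f x z : cmean i f (updv x i z) = cmean i f x.
Proof. by apply: eq_Rintegral => z' _; rewrite updv_id. Qed.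

Lemma cmeanB i f g x : lipschitzv f -> lipschitzv g ->
  cmean i (fun x => f x - g x) x = cmean i f x - cmean i g x.
Proof.
move=> Lf Lg; rewrite /cmean RintegralB//;
  exact: (sqr_integrable_integrable (lipschitzv_line_sqr_integrable _ _ _)).
Qed.

Lemma cmean_const i h x : (forall x z, h (updv x i z) = h x) -> cmean i h x = h x.
Proof.
move=> hi; rewrite /cmean.
under eq_Rintegral do rewrite hi.
exact: probability_Rintegral_cst.
Qed.

Lemma mean_cmean i f : lipschitzv f ->
  \int[P]_w f (eps w) = \int[P]_w cmean i f (eps w).
Proof.
move=> Lf; apply: Rintegral_resample.
- exact: lipschitzv_measurable.
- exact: sqr_integrable_integrable (lipschitzv_sqr_integrable Lf).
- by move=> x; exact: sqr_integrable_integrable (lipschitzv_line_sqr_integrable _ _ Lf).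
Qed.

(** [cmean i f] is constant along coordinate i and leaves the inner integral: [cmean i] acts as an
    orthogonal projection. *)
Lemma mean_mul_cmean i f : lipschitzv f ->
  \int[P]_w (f (eps w) * cmean i f (eps w)) = \int[P]_w cmean i f (eps w) ^+ 2.
Proof.
move=> Lf; have Lc := cmean_lipschitzv i Lf.
rewrite (@Rintegral_resample i (fun x => f x * cmean i f x)); last 3 first.
- by apply: measurable_funM; exact: lipschitzv_measurable.
- exact: (sqr_integrableM (lipschitzv_sqr_integrable Lf) (lipschitzv_sqr_integrable Lc)).
- move=> x; exact: (sqr_integrableM (lipschitzv_line_sqr_integrable x i Lf)
    (lipschitzv_line_sqr_integrable x i Lc)).
apply: eq_Rintegral => w _.
under eq_Rintegral do rewrite cmean_updv.
rewrite RintegralZr// ?expr2//.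
exact: sqr_integrable_integrable (lipschitzv_line_sqr_integrable _ _ Lf).
Qed.

(** The expected conditional variance in coordinate i. *)
Definition cvar i f : R := \int[P]_w (f (eps w) - cmean i f (eps w)) ^+ 2.

Lemma cvar_ge0 i f : 0 <= cvar i f.
Proof. by apply: Rintegral_ge0 => w _; rewrite sqr_ge0. Qed.

Lemma mean_sqr_cmean i f : lipschitzv f ->
  \int[P]_w f (eps w) ^+ 2 = cvar i f + \int[P]_w cmean i f (eps w) ^+ 2.
Proof.
move=> Lf; have Lc := cmean_lipschitzv i Lf.
rewrite /cvar (Rintegral_sqrB (lipschitzv_sqr_integrable Lf) (lipschitzv_sqr_integrable Lc)).
by rewrite /= mean_mul_cmean//; ring.
Qed.

(** A projection is the best approximation: Pythagoras is applied to f - h, and h is fixed by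
    [cmean i]. *)
Lemma cvar_le i f h : lipschitzv f -> lipschitzv h ->
  (forall x z, h (updv x i z) = h x) ->
  cvar i f <= \int[P]_w (f (eps w) - h (eps w)) ^+ 2.
Proof.
move=> Lf Lh hi; rewrite (mean_sqr_cmean i (lipschitzvB Lf Lh)).
have -> : cvar i (fun x => f x - h x) = cvar i f.
  apply: eq_Rintegral => w _; rewrite cmeanB// (cmean_const _ hi).
  by congr (_ ^+ 2); ring.
by rewrite lerDl; apply: Rintegral_ge0 => w _; rewrite sqr_ge0.
Qed.

(** Best approximation with the competitor [cmean j (cmean i f)], which ignores coordinate i,
    followed by the L^2 contraction of [cmean j]. The two averages are thus never interchanged. *)
Lemma cvar_cmean i j f : i != j -> lipschitzv f -> cvar i (cmean j f) <= cvar i f.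
Proof.
move=> ij Lf; have Lc := cmean_lipschitzv i Lf.
have inv x z : cmean j (cmean i f) (updv x i z) = cmean j (cmean i f) x.
  by apply: eq_Rintegral => z' _; rewrite updvC// cmean_updv.
apply: le_trans (cvar_le (cmean_lipschitzv j Lf) (cmean_lipschitzv j Lc) inv) _.
have Lu := lipschitzvB Lf Lc.
rewrite [leRHS](mean_sqr_cmean j Lu).
have -> : \int[P]_w (cmean j f (eps w) - cmean j (cmean i f) (eps w)) ^+ 2 =
    \int[P]_w cmean j (fun x => f x - cmean i f x) (eps w) ^+ 2.
  by apply: eq_Rintegral => w _; rewrite cmeanB.
by rewrite lerDr cvar_ge0.
Qed.

Definition cmeans (r : seq 'I_n) f := foldr cmean f r.

Lemma cmeans_lipschitzv r f : lipschitzv f -> lipschitzv (cmeans r f).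
Proof. by move=> Lf; elim: r => //= i r; exact: cmean_lipschitzv. Qed.

Lemma cvar_cmeans i r f : i \notin r -> lipschitzv f ->
  cvar i (cmeans r f) <= cvar i f.
Proof.
move=> + Lf; elim: r => //= j r IH; rewrite inE negb_or => /andP[ij ir].
exact: le_trans (cvar_cmean ij (cmeans_lipschitzv r Lf)) (IH ir).
Qed.

(** Pythagoras once per coordinate. Each step loses the conditional variance of a partly averaged
    function, which is at most that of f because no coordinate repeats. *)
Lemma mean_sqr_cmeans r f : uniq r -> lipschitzv f ->
  \int[P]_w f (eps w) ^+ 2 <=
  \sum_(i <- r) cvar i f + \int[P]_w cmeans r f (eps w) ^+ 2.
Proof.
move=> + Lf; elim: r => [_|i r IH /= /andP[ir ur]]; first by rewrite big_nil add0r.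
apply: le_trans (IH ur) _; rewrite big_cons.
rewrite (mean_sqr_cmean i (cmeans_lipschitzv r Lf)).
by rewrite addrA lerD2r addrC lerD2r cvar_cmeans.
Qed.

Lemma mean_cmeans r f : lipschitzv f ->
  \int[P]_w cmeans r f (eps w) = \int[P]_w f (eps w).
Proof.
move=> Lf; elim: r => //= i r <-; rewrite -mean_cmean//.
exact: cmeans_lipschitzv.
Qed.

Lemma cmeans_updv i r f x z : i \in r -> cmeans r f (updv x i z) = cmeans r f x.
Proof.
elim: r x => //= j r IH x; rewrite inE.
have [<- _|ij /= ir] := eqVneq i j; first by rewrite cmean_updv.
by apply: eq_Rintegral => z' _; rewrite updvC// IH.
Qed.

Lemma updv_invariant_cst g :
  (forall i x z, g (updv x i z) = g x) -> forall x y, g x = g y.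
Proof.
move=> gi x y.
(* Interpolates from x to y by changing the coordinates one at a time. *)
pose w (r : seq 'I_n) : 'cV[R]_n := \col_j (if j \in r then y j 0 else x j 0).
have gw r : g (w r) = g x.
  elim: r => [|i r IH].
    by congr g; apply/colP => j; rewrite mxE.
  rewrite -IH -(gi i (w r) (y i 0)); congr g; apply/colP => j.
  by rewrite !mxE inE; case: eqP => // ->.
rewrite -(gw (index_enum 'I_n)); congr g; apply/colP => j.
by rewrite mxE mem_index_enum.
Qed.

(** Once every coordinate is averaged out, the function is constant and equal to the mean, so its
    second moment is the squared mean. *)
Lemma efron_stein f : lipschitzv f ->
  \int[P]_w f (eps w) ^+ 2 <=
  (\int[P]_w f (eps w)) ^+ 2 + \sum_(i < n) cvar i f.
Proof.
move=> Lf; have := mean_sqr_cmeans (index_enum_uniq 'I_n) Lf.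
move=> /le_trans; apply; rewrite addrC lerD2r.
rewrite -(mean_cmeans (index_enum 'I_n) Lf).
set g := cmeans _ f.
have gc x y : g x = g y.
  apply: updv_invariant_cst => i {}x z; apply: cmeans_updv.
  exact: mem_index_enum.
under eq_Rintegral do rewrite (gc _ 0).
under [X in _ <= X ^+ 2]eq_Rintegral do rewrite (gc _ 0).
by rewrite !probability_Rintegral_cst.
Qed.

End coordinate_mean.

(** * The Gaussian Poincare inequality and suprema of affine functions *)

Section gaussian_poincare.
Context {R : realType} {d : measure_display} {Omega : measurableType d}.
Variables (P : probability Omega R) (n : nat) (s : R) (eps : Omega -> 'cV[R]_n).
Hypotheses (s_gt0 : 0 < s) (eps_gauss : gaussian_noise P s eps).

Local Notation N := (normal_prob (0 : R) s).

Lemma measurable_integral_resample i (f : cvM -> \bar R) :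
  measurable_fun [set: cvM] f -> (forall x, 0 <= f x)%E ->
  measurable_fun [set: Omega] (fun w => \int[N]_z f (updv (eps w) i z))%E.
Proof.
move=> mf f0.
have mfr : measurable_fun [set: Omega * R] (f \o resample eps i).
  exact: measurableT_comp mf (measurable_resample eps_gauss i).
have fr0 (wz : Omega * R) : (0 <= (f \o resample eps i) wz)%E by exact: f0.
have := @measurable_fun_fubini_tonelli_F _ _ _ _ R N (f \o resample eps i).
by apply.
Qed.

Lemma gaussian_poincare (f : 'cV[R]_n -> R) (D : 'I_n -> 'cV[R]_n -> R) (t : R) :
  lipschitzv f ->
  (forall x i (z : R), is_derive z 1 (fun z => f (updv x i z)) (D i (updv x i z))) ->
  (forall x i, continuous (fun z => D i (updv x i z))) ->
  (forall i, measurable_fun [set: cvM] (D i)) ->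
  (forall x, \sum_(i < n) D i x ^+ 2 <= t ^+ 2) ->
  \int[P]_w f (eps w) ^+ 2 <= (\int[P]_w f (eps w)) ^+ 2 + s ^+ 2 * t ^+ 2.
Proof.
move=> Lf df cD mD Dt.
apply: le_trans (efron_stein s_gt0 eps_gauss Lf) _; rewrite lerD2l.
have mN := measurable_noise eps_gauss.
have iD i : sqr_integrable P (D i \o eps).
  apply: sqr_integrable_le (sqr_integrable_cst P t) _.
    exact: measurableT_comp (mD i) mN.
  move=> w /=; rewrite -ler_sqr ?nnegrE// !real_normK ?num_real//.
  apply: le_trans (Dt (eps w)); rewrite (bigD1 i)//= lerDl.
  by apply: sumr_ge0 => j _; rewrite sqr_ge0.
have key i : cvar P s eps i f <= \int[P]_w (s ^+ 2 * D i (eps w) ^+ 2).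
  (* Freezing coordinate i at 0 gives a competitor to the conditional mean that matches the centring
     of the one-dimensional inequality. *)
  pose h x := f (updv x i 0).
  have Lh : lipschitzv h.
    case: Lf => L L0 Lf; exists L => // x y; apply: le_trans (Lf _ (updv y i 0)) _.
    by rewrite lerD2l ler_wpM2l// l2norm_updv.
  have hi x z : h (updv x i z) = h x by rewrite /h updv_id.
  apply: le_trans (cvar_le s_gt0 eps_gauss Lf Lh hi) _.
  have Lfh := lipschitzvB Lf Lh.
  have [_ ifh] := lipschitzv_sqr_integrable s_gt0 eps_gauss Lfh.
  have isD : P.-integrable [set: Omega] (EFin \o (fun w => s ^+ 2 * D i (eps w) ^+ 2)).
    exact: (integrableZl measurableT (s ^+ 2) (iD i).2).
  apply: fine_le.
  - exact: integrable_fin_num ifh.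
  - exact: integrable_fin_num isD.
  have m1 : measurable_fun [set: cvM] (fun x => ((f x - h x) ^+ 2)%:E).
    by apply/measurable_EFinP; apply: measurable_funX; exact: lipschitzv_measurable.
  have m2 : measurable_fun [set: cvM] (fun x => (s ^+ 2 * D i x ^+ 2)%:E).
    by apply/measurable_EFinP; apply: measurable_funM => //; apply: measurable_funX.
  rewrite (ge0_integral_resample eps_gauss i m1); last first.
    by move=> x; rewrite lee_fin sqr_ge0.
  rewrite (ge0_integral_resample eps_gauss i m2); last first.
    by move=> x; rewrite lee_fin mulr_ge0 ?sqr_ge0.
  apply: ge0_le_integral => //.
  - by move=> w _; apply: integral_ge0 => z _; rewrite lee_fin sqr_ge0.
  - apply: (measurable_integral_resample i m1).
    by move=> x; rewrite lee_fin sqr_ge0.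
  - apply: (measurable_integral_resample i m2).
    by move=> x; rewrite lee_fin mulr_ge0 ?sqr_ge0.
  - move=> w _.
    have := poincare_normal1 s_gt0 (df (eps w) i) (cD (eps w) i).
    by under [X in _ -> (X <= _)%E]eq_integral do rewrite hi.
apply: le_trans (ler_sum _ (fun i _ => key i)) _.
have isD i : P.-integrable [set: Omega] (EFin \o (fun w => s ^+ 2 * D i (eps w) ^+ 2)).
  exact: (integrableZl measurableT (s ^+ 2) (iD i).2).
have sumE (r : seq 'I_n) :
    P.-integrable [set: Omega] (EFin \o (fun w => \sum_(i <- r) s ^+ 2 * D i (eps w) ^+ 2)) /\
    \sum_(i <- r) \int[P]_w (s ^+ 2 * D i (eps w) ^+ 2) =
    \int[P]_w \sum_(i <- r) (s ^+ 2 * D i (eps w) ^+ 2).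
  elim: r => [|i r [IH1 IH2]].
    rewrite big_nil; split.
      apply: eq_integrable (finite_measure_integrable_cst P (0 : R) measurableT) => //.
      by move=> w _; rewrite /= big_nil.
    by under eq_Rintegral do rewrite big_nil; rewrite probability_Rintegral_cst.
  split.
    have := integrableD measurableT (isD i) IH1.
    by apply: eq_integrable => // w _; rewrite /= big_cons EFinD.
  under [RHS]eq_Rintegral do rewrite big_cons.
  by rewrite RintegralD// -IH2 big_cons.
have [iS ->] := sumE (index_enum 'I_n).
rewrite -[leRHS](probability_Rintegral_cst P); apply: le_Rintegral => //.
  exact: finite_measure_integrable_cst.
by move=> w _; rewrite -mulr_sumr ler_wpM2l ?sqr_ge0.
Qed.

End gaussian_poincare.

Section supremum_of_affine_lipschitz.
Context {R : realType} {n : nat} {I : Type}.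
Variables (a : I -> 'cV[R]_n) (c : I -> R) (t : R) (phi : 'cV[R]_n -> R).
Hypothesis a_le : forall k, l2norm (a k) <= t.
Hypothesis phi_ub : forall x k, dotv x (a k) - c k <= phi x.
Hypothesis phi_approx : forall x e, 0 < e ->
  exists k, phi x - e < dotv x (a k) - c k.

Lemma affine_lipv k : lipv t (fun x => dotv x (a k) - c k).
Proof.
move=> x y; rewrite addrAC lerD2r -lerBlDl -dotvBl.
apply: le_trans (dotv_le _ _) _; rewrite mulrC.
by rewrite ler_wpM2r ?l2norm_ge0.
Qed.

Lemma sup_affine_lipv : lipv t phi.
Proof.
move=> x y; apply/ler_addgt0Pr => e e0.
have [k hk] := phi_approx x e0; have := phi_ub y k.
have := affine_lipv k x y; lra.
Qed.

End supremum_of_affine_lipschitz.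

(** * Log-sum-exp as a smooth maximum *)

Section softmax.
Context {R : realType} {n : nat}.
Variables (a : nat -> 'cV[R]_n) (c : nat -> R) (t : R).
Hypotheses (t_ge0 : 0 <= t) (a_le : forall k, l2norm (a k) <= t).
Variables (m : nat) (tau : R).
Hypothesis tau_gt0 : 0 < tau.
Implicit Types x y : 'cV[R]_n.

Let u k x := dotv x (a k) - c k.
Let S x := \sum_(k < m.+1) expR (u k x / tau).

(** Here tau is a temperature: the value lies between the maximum of the first [m.+1] affine
    functions and that maximum plus tau ln m.+1. *)
Definition softmax x : R := tau * ln (S x).

Let S_gt0 x : 0 < S x.
Proof.
rewrite /S big_ord_recl ltr_wpDr ?expR_gt0//.
by apply: sumr_ge0 => k _; rewrite expR_ge0.
Qed.

Lemma le_softmax (k : 'I_m.+1) x : u k x <= softmax x.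
Proof.
rewrite /softmax mulrC -ler_pdivrMr// -ler_expR lnK ?posrE// /S (bigD1 k)//= lerDl.
by apply: sumr_ge0 => j _; rewrite expR_ge0.
Qed.

(** Common core of two estimates: Y = m.+1 gives the upper bound by the maximum, and Y = S y gives
    the Lipschitz bound. *)
Lemma softmax_shift_le M x (Y : R) : 0 < Y -> S x <= Y * expR (M / tau) ->
  softmax x <= tau * ln Y + M.
Proof.
move=> Y0 SY; rewrite -[X in _ + X](divfK (lt0r_neq0 tau_gt0)) [X in _ + X]mulrC -mulrDr.
rewrite /softmax ler_pM2l// -[X in _ + X]expRK -lnM ?posrE ?expR_gt0//.
by rewrite ler_ln ?posrE ?mulr_gt0 ?expR_gt0.
Qed.

Lemma softmax_le M x : (forall k, u k x <= M) ->
  softmax x <= tau * ln m.+1%:R + M.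
Proof.
move=> uM; apply: softmax_shift_le => //.
apply: (@le_trans _ _ (\sum_(k < m.+1) expR (M / tau))).
  by apply: ler_sum => k _; rewrite ler_expR ler_pM2r ?invr_gt0.
by rewrite sumr_const card_ord mulr_natl.
Qed.

Let u_lip k x y : u k x <= u k y + t * l2norm (x - y).
Proof. exact: (affine_lipv c a_le). Qed.

Lemma softmax_lipv : lipv t softmax.
Proof.
move=> x y; apply: softmax_shift_le => //.
rewrite {2}/S mulr_suml; apply: ler_sum => k _.
by rewrite -expRD -mulrDl ler_expR ler_pM2r ?invr_gt0.
Qed.

(** The Gibbs weights. This form yields continuity and measurability directly; the quotient form
    [wE] serves for the derivative and for the sum being 1. *)
Let w k x := expR ((u k x - softmax x) / tau).

Let wE k x : w k x = expR (u k x / tau) / S x.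
Proof.
rewrite /w mulrBl expRD expRN; congr (_ / _).
by rewrite /softmax mulrC mulKf ?gt_eqF// lnK ?posrE.
Qed.

Let sum_w x : \sum_(k < m.+1) w k x = 1.
Proof.
under eq_bigr do rewrite wE.
by rewrite -mulr_suml; exact: divff (lt0r_neq0 (S_gt0 x)).
Qed.

Definition softmax_grad x : 'cV[R]_n := \sum_(k < m.+1) w k x *: a k.

(** The gradient is a convex combination of the slopes a k. *)
Lemma l2norm_softmax_grad x : l2norm (softmax_grad x) <= t.
Proof.
rewrite -[leRHS]mul1r -(sum_w x) mulr_suml /softmax_grad.
elim/big_ind2 : _ => [|u1 r1 u2 r2 h1 h2|k _].
- by rewrite l2norm0.
- by apply: le_trans (l2normD _ _) _; exact: lerD.
- by rewrite l2normZ ger0_norm ?expR_ge0// ler_wpM2l ?expR_ge0.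
Qed.

Let dotv_updv x i z k : dotv (updv x i z) (a k) = dotv (updv x i 0) (a k) + z * a k i 0.
Proof.
rewrite /dotv (bigD1 i)//= [in RHS](bigD1 i)//= !mxE eqxx mul0r add0r addrC.
by congr (_ + _); apply: eq_bigr => j /negbTE ji; rewrite !mxE ji.
Qed.

Lemma is_derive_softmax x i (z : R) :
  is_derive z 1 (fun z => softmax (updv x i z)) (softmax_grad (updv x i z) i 0).
Proof.
pose e (k : 'I_m.+1) (z : R) := expR (u k (updv x i z) / tau).
have de k : is_derive z 1 (e k) (e k z * (a k i 0 / tau)).
  have -> : e k = expR \o (fun z => u k (updv x i 0) / tau + (a k i 0 / tau) *: z).
    apply/funext => z'; rewrite /e /u /= dotv_updv /GRing.scale /=.
    by congr expR; field; rewrite gt_eqF.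
  apply: is_derive1_comp.
  apply: (is_derive_eq (is_deriveD (is_derive_cst (u k (updv x i 0) / tau) z 1)
    (is_deriveZ (a k i 0 / tau) (is_derive_id z 1)))).
  by rewrite add0r /GRing.scale /= mulr1.
have dS := is_derive_sum de.
have SE : (\sum_(k < m.+1) e k) = (fun z => S (updv x i z)).
  by apply/funext => z'; rewrite fct_sumE.
rewrite SE in dS.
have dln := is_derive1_ln (S_gt0 (updv x i z)).
apply: (is_derive_eq (is_deriveZ tau (is_derive1_comp dln dS))).
rewrite /GRing.scale /= /softmax_grad summxE !mulr_sumr; apply: eq_bigr => k _.
rewrite mxE wE /e; field.
by rewrite !gt_eqF.
Qed.

Let cu k x i : continuous (fun z => u k (updv x i z)).
Proof.
have -> : (fun z => u k (updv x i z)) = (fun z => u k (updv x i 0) + z * a k i 0).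
  by apply/funext => z; rewrite /u dotv_updv addrAC.
move=> z; apply: cvgD; first exact: cvg_cst.
by apply: cvgM; [exact: cvg_id|exact: cvg_cst].
Qed.

Lemma continuous_softmax_grad x i :
  continuous (fun z => softmax_grad (updv x i z) i 0).
Proof.
have csm : continuous (fun z => softmax (updv x i z)).
  exact: continuous_is_derive (is_derive_softmax x i).
have -> : (fun z => softmax_grad (updv x i z) i 0) =
    \sum_(k < m.+1) (fun z => w k (updv x i z) * a k i 0).
  by apply/funext => z; rewrite fct_sumE summxE; apply: eq_bigr => k _; rewrite mxE.
elim/big_ind : _ => [|f g cf cg|k _]; first exact: cst_continuous.
  by move=> z; apply: cvgD; [exact: cf|exact: cg].
move=> z; apply: cvgM; last exact: cvg_cst.
apply: (cvg_comp _ expR); last exact: continuous_expR.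
apply: cvgM; last exact: cvg_cst.
by apply: cvgB; [exact: cu|exact: csm].
Qed.

Lemma measurable_softmax_grad i :
  measurable_fun [set: cvM] (fun x => softmax_grad x i 0).
Proof.
rewrite /softmax_grad; under eq_fun do rewrite summxE.
apply: measurable_sum => k; under eq_fun do rewrite mxE.
apply: measurable_funM => //; apply: measurableT_comp => //.
apply: measurable_funM => //; apply: measurable_funB.
  exact: (measurable_lipv t_ge0 (u_lip k)).
exact: (measurable_lipv t_ge0 softmax_lipv).
Qed.

End softmax.

(** * Variance of a supremum of affine functions *)

Section supremum_of_affine.
Context {R : realType} {d : measure_display} {Omega : measurableType d}.
Variables (P : probability Omega R) (n : nat) (s : R) (eps : Omega -> 'cV[R]_n).
Hypotheses (s_gt0 : 0 < s) (eps_gauss : gaussian_noise P s eps).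
Variables (a : nat -> 'cV[R]_n) (c : nat -> R) (t : R) (phi : 'cV[R]_n -> R).
Hypotheses (t_ge0 : 0 <= t) (a_le : forall k, l2norm (a k) <= t).
Hypothesis phi_ub : forall x k, dotv x (a k) - c k <= phi x.
Hypothesis phi_approx : forall x e, 0 < e ->
  exists k, phi x - e < dotv x (a k) - c k.

(** Since ln x < x, this temperature brings the error tau ln m.+1 below 1 / m.+1. *)
Let tau m : R := (m.+1%:R ^+ 2)^-1.

Let tau_gt0 m : 0 < tau m. Proof. by rewrite invr_gt0 exprn_gt0. Qed.

Let psi m := softmax a c m (tau m).

Let psi_ub m x : psi m x <= m.+1%:R^-1 + phi x.
Proof.
apply: le_trans (@softmax_le _ _ a c m (tau m) (tau_gt0 m) _ x (phi_ub x)) _; rewrite lerD2r.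
apply: (@le_trans _ _ (tau m * m.+1%:R)).
  by rewrite ler_wpM2l ?(ltW (tau_gt0 m))// ltW// ln_sublinear.
by rewrite /tau expr2 invfM mulfVK.
Qed.

Let psi_cvg x : psi m x @[m --> \oo] --> phi x.
Proof.
apply/cvgrPdist_le => e e0; have [k hk] := phi_approx x e0.
near=> m.
have km : (k < m.+1)%N by near: m; exact: nbhs_infty_ge.
have h1 : dotv x (a k) - c k <= psi m x.
  exact: (@le_softmax _ _ a c m (tau m) (tau_gt0 m) (Ordinal km) x).
have h2 : psi m x <= e + phi x.
  apply: le_trans (psi_ub m x) _; rewrite lerD2r ltW//.
  by near: m; exact: near_infty_natSinv_lt (PosNum e0).
rewrite ler_norml; apply/andP; split; lra.
Unshelve. all: by end_near. Qed.

Lemma sup_affine_sequence_variance :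
  \int[P]_w phi (eps w) ^+ 2 <= (\int[P]_w phi (eps w)) ^+ 2 + s ^+ 2 * t ^+ 2.
Proof.
have Lphi : lipschitzv phi by exists t => //; exact: (sup_affine_lipv a_le phi_ub).
have Lpsi m : lipschitzv (psi m) by exists t => //; exact: softmax_lipv.
pose u0 x := dotv x (a 0%N) - c 0%N.
have Lu0 : lipschitzv u0 by exists t => //; exact: (affine_lipv c a_le).
(* Dominates every psi m, because u0 <= psi m <= 1 + phi; both moments then pass to the limit by
   dominated convergence. *)
pose G w := `|phi (eps w)| + 1 + `|u0 (eps w)|.
have sq_abs f : sqr_integrable P f -> sqr_integrable P (fun w => `|f w|).
  move=> sf; apply: (sqr_integrable_le _ sf) => [|w]; last by rewrite normr_id.
  by apply: measurableT_comp => //; case: sf.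
have sphi := lipschitzv_sqr_integrable s_gt0 eps_gauss Lphi.
have spsi m := lipschitzv_sqr_integrable s_gt0 eps_gauss (Lpsi m).
have sG : sqr_integrable P G.
  apply: sqr_integrableD; [apply: sqr_integrableD; [exact: sq_abs|exact: sqr_integrable_cst]|].
  exact/sq_abs/(lipschitzv_sqr_integrable s_gt0 eps_gauss Lu0).
have psiG m w : `|psi m (eps w)| <= G w.
  have h1 : psi m (eps w) <= 1 + phi (eps w).
    by apply: le_trans (psi_ub m (eps w)) _; rewrite lerD2r invf_le1// ler1n.
  have h2 : u0 (eps w) <= psi m (eps w) := @le_softmax _ _ a c m (tau m) (tau_gt0 m) ord0 (eps w).
  have h4 := ler_norm (phi (eps w)); have h5 := ler_norm (- u0 (eps w)).
  rewrite normrN in h5; have h6 := normr_ge0 (phi (eps w)).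
  have h7 := normr_ge0 (u0 (eps w)).
  by rewrite /G ler_norml; apply/andP; split; lra.
have cv2 : (\int[P]_w psi m (eps w) ^+ 2) @[m --> \oo] --> \int[P]_w phi (eps w) ^+ 2.
  apply: fine_cvg; rewrite fineK; last exact: integrable_fin_num sphi.2.
  apply: (@dominated_cvg _ _ _ P setT measurableT _ _ (fun w => (G w ^+ 2)%:E)) => //.
  - by move=> m; apply/measurable_EFinP/measurable_funX; exact: (spsi m).1.
  - move=> w _ /=; apply: cvg_EFin; first exact: nearW.
    by apply: cvgM; exact: psi_cvg.
  - exact: sG.2.
  - move=> m w _ /=; rewrite lee_fin normrX.
    by apply: lerXn2r; rewrite ?nnegrE// (le_trans _ (psiG m w)).
have cv1 : (\int[P]_w psi m (eps w)) @[m --> \oo] --> \int[P]_w phi (eps w).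
  apply: fine_cvg; rewrite fineK; last exact: integrable_fin_num (sqr_integrable_integrable sphi).
  apply: (@dominated_cvg _ _ _ P setT measurableT _ _ (fun w => (G w)%:E)) => //.
  - by move=> m; apply/measurable_EFinP; exact: (spsi m).1.
  - move=> w _ /=; apply: cvg_EFin; first exact: nearW.
    exact: psi_cvg.
  - exact: sqr_integrable_integrable sG.
  - by move=> m w _ /=; rewrite lee_fin.
apply: (ler_cvg_to cv2 (cvgD (cvgM cv1 cv1) (cvg_cst (s ^+ 2 * t ^+ 2)))).
apply: nearW => m.
rewrite -[leRHS]/((\int[P]_w psi m (eps w)) ^+ 2 + s ^+ 2 * t ^+ 2).
apply: (gaussian_poincare s_gt0 eps_gauss (D := fun i x => softmax_grad a c m (tau m) x i 0)).
- exact: Lpsi.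
- by move=> x i z; exact: is_derive_softmax.
- by move=> x i; exact: continuous_softmax_grad.
- by move=> i; exact: (measurable_softmax_grad c t_ge0 a_le m (tau_gt0 m)).
- move=> x; rewrite [leLHS](_ : _ = l2norm (softmax_grad a c m (tau m) x) ^+ 2).
    by apply: lerXn2r; rewrite ?nnegrE ?l2norm_ge0//; exact: l2norm_softmax_grad.
  by rewrite l2norm_sqr; apply: eq_bigr => i _; rewrite expr2.
Qed.

End supremum_of_affine.

(** Reduction of an arbitrary index type to a sequence: near-optimal indices are chosen at each
    rational vector and each precision 1 / l.+1, and the common Lipschitz bound makes them
    near-optimal at all other vectors. *)
Lemma sup_affine_variance (R : realType) (d : measure_display)
    (Omega : measurableType d) (P : probability Omega R) (n : nat) (s : R)
    (eps : Omega -> 'cV[R]_n) (I : Type) (a : I -> 'cV[R]_n) (c : I -> R) (t : R)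
    (phi : 'cV[R]_n -> R) :
  0 < s -> gaussian_noise P s eps -> 0 <= t -> (forall k, l2norm (a k) <= t) ->
  (forall x k, dotv x (a k) - c k <= phi x) ->
  (forall x e, 0 < e -> exists k, phi x - e < dotv x (a k) - c k) ->
  \int[P]_w phi (eps w) ^+ 2 <= (\int[P]_w phi (eps w)) ^+ 2 + s ^+ 2 * t ^+ 2.
Proof.
move=> s0 eps_gauss t0 a_le phi_ub phi_approx.
have Lphi := sup_affine_lipv a_le phi_ub phi_approx.
have inv0 (l : nat) : 0 < l.+1%:R^-1 :> R by rewrite invr_gt0.
pose Q (q : 'cV[rat]_n) : 'cV[R]_n := map_mx ratr q.
pose sel (q : 'cV[rat]_n) (l : nat) : I := sval (cid (phi_approx (Q q) _ (inv0 l))).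
have selP q l : phi (Q q) - l.+1%:R^-1 < dotv (Q q) (a (sel q l)) - c (sel q l).
  by rewrite /sel; case: cid.
pose idx (k : nat) : I :=
  if unpickle k is Some (q, l) then sel q l else sel 0 0%N.
apply: (@sup_affine_sequence_variance _ _ _ _ _ _ _ s0 eps_gauss (a \o idx) (c \o idx) t) => //.
- by move=> k; exact: a_le.
- by move=> x k; exact: phi_ub.
move=> x e e0.
(* Three errors of at most e / 4: moving phi to the rational vector, the choice of the index there,
   and moving the affine function back. *)
have e4 : 0 < e / 4 by lra.
have t1 : 0 < e / 4 / (t + 1) by rewrite divr_gt0//; lra.
have [q xq] := rational_dense_l2norm x t1.
have [l hl] : exists l : nat, l.+1%:R^-1 < e / 4.
  have [l _ H] := near_infty_natSinv_lt (PosNum e4).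
  by exists l; exact: (H l (leqnn l)).
exists (pickle (q, l)); rewrite /= /idx pickleK.
have h1 := selP q l; have h2 := Lphi x (Q q).
have h3 := affine_lipv c a_le (sel q l) (Q q) x.
rewrite l2normB in h3.
have h4 : t * l2norm (x - Q q) <= e / 4.
  move: xq; rewrite ltr_pdivlMr; last lra.
  rewrite -/(Q q); set r := l2norm _ => rt.
  have r0 : 0 <= r by exact: l2norm_ge0.
  by apply: le_trans (ltW rt); rewrite mulrDr mulr1 mulrC lerDl.
have h5 : phi (Q q) - e / 4 < dotv (Q q) (a (sel q l)) - c (sel q l).
  by apply: lt_trans h1; rewrite ltrD2l ltrN2.
clear h1 hl; lra.
Qed.

(** * Deviation of the prediction error *)

Section penalized_least_squares.
Context {R : realType} {n p : nat}.
Variables (X : 'M[R]_(n, p)) (betas : 'cV[R]_p) (h : 'cV[R]_p -> \bar R).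
Hypotheses (h_ge0 : forall b, (0 <= h b)%E) (h_convex : econvex h).
Implicit Types (e : 'cV[R]_n) (b : 'cV[R]_p) (t : R).

Definition pred_err b : 'cV[R]_n := X *m (b - betas).

(** [fine] sends +oo to 0, so the value is meaningful only where h is finite; [admissible] therefore
    includes that condition. *)
Definition obj e b : R := dotv e (pred_err b) - fine (h b).

Definition admissible t : set 'cV[R]_p :=
  [set b | (h b < +oo)%E /\ l2norm (pred_err b) <= t].

(** A real supremum, to be read only for radii with an admissible point; [sup] of the empty set is
    0, not -oo. *)
Definition supobj e t : R := sup [set obj e b | b in admissible t].

Lemma pred_err_conv a b1 b2 :
  pred_err (a *: b1 + (1 - a) *: b2) = a *: pred_err b1 + (1 - a) *: pred_err b2.
Proof.
rewrite /pred_err !scalemxAr -mulmxDr; congr (_ *m _).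
rewrite !scalerBr addrACA -opprD -scalerDl.
by rewrite (addrC a) subrK scale1r.
Qed.

Lemma finite_pen b : (h b < +oo)%E -> h b = (fine (h b))%:E.
Proof. by move=> hb; rewrite fineK// ge0_fin_numE. Qed.

Lemma finite_pen_conv a b1 b2 : 0 <= a <= 1 -> (h b1 < +oo)%E -> (h b2 < +oo)%E ->
  (h (a *: b1 + (1 - a) *: b2) < +oo)%E /\
  fine (h (a *: b1 + (1 - a) *: b2)) <= a * fine (h b1) + (1 - a) * fine (h b2).
Proof.
move=> a01 h1 h2; have := h_convex b1 b2 a01.
rewrite (finite_pen h1) (finite_pen h2) -!EFinM -EFinD => hle.
have hfin : (h (a *: b1 + (1 - a) *: b2) < +oo)%E by rewrite (le_lt_trans hle)// ltry.
by split => //; move: hle; rewrite {1}(finite_pen hfin) lee_fin.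
Qed.

Lemma obj_conv e a b1 b2 : 0 <= a <= 1 -> (h b1 < +oo)%E -> (h b2 < +oo)%E ->
  a * obj e b1 + (1 - a) * obj e b2 <= obj e (a *: b1 + (1 - a) *: b2).
Proof.
move=> a01 h1 h2; have [_ hle] := finite_pen_conv a01 h1 h2.
rewrite /obj pred_err_conv dotvDr !dotvZr.
by rewrite !mulrBr addrACA -opprD lerD2l lerN2.
Qed.

Lemma obj_ub e t b : admissible t b -> obj e b <= l2norm e * t.
Proof.
move=> [_ bt]; rewrite /obj lerBlDr.
apply: le_trans (dotv_le _ _) _.
apply: (@le_trans _ _ (l2norm e * t)); first by rewrite ler_wpM2l ?l2norm_ge0.
by rewrite lerDl fine_ge0.
Qed.

Lemma has_sup_obj e t : admissible t !=set0 ->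
  has_sup [set obj e b | b in admissible t].
Proof.
move=> [b ab]; split; first by exists (obj e b), b.
by exists (l2norm e * t) => _ [b' ab' <-]; exact: obj_ub.
Qed.

Lemma supobj_ub e t b : admissible t b -> obj e b <= supobj e t.
Proof.
move=> ab; apply: sup_upper_bound; last by exists b.
by apply: has_sup_obj; exists b.
Qed.

Lemma supobj_le e t M : admissible t !=set0 ->
  (forall b, admissible t b -> obj e b <= M) -> supobj e t <= M.
Proof.
move=> [b ab] HM; apply: sup_le_ub; first by exists (obj e b), b.
by move=> _ [b' ab' <-]; exact: HM.
Qed.

Lemma supobj_approx e t (r : R) : admissible t !=set0 -> 0 < r ->
  exists2 b, admissible t b & supobj e t - r < obj e b.
Proof.
move=> at0 r0; have [_ [b ab <-] br] := sup_adherent r0 (has_sup_obj e at0).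
by exists b.
Qed.

(** Near-maximizers at t1 and t2 combine into a competitor for the intermediate radius, where the
    triangle inequality keeps it. *)
Lemma supobj_conv e a t1 t2 : 0 <= a <= 1 -> admissible t1 !=set0 ->
  admissible t2 !=set0 ->
  a * supobj e t1 + (1 - a) * supobj e t2 <= supobj e (a * t1 + (1 - a) * t2).
Proof.
move=> /[dup] a01 /andP[a0 a1] at1 at2; apply/ler_addgt0Pr => r r0.
have [b1 ab1 h1] := supobj_approx e at1 r0.
have [b2 ab2 h2] := supobj_approx e at2 r0.
have a1' : 0 <= 1 - a by rewrite subr_ge0.
have [hfin _] := finite_pen_conv a01 ab1.1 ab2.1.
have ab : admissible (a * t1 + (1 - a) * t2) (a *: b1 + (1 - a) *: b2).
  split => //; rewrite pred_err_conv; apply: le_trans (l2normD _ _) _.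
  by rewrite !l2normZ !ger0_norm// lerD// ler_wpM2l//; [case: ab1|case: ab2].
have := supobj_ub e ab; have := obj_conv e a01 ab1.1 ab2.1.
have := ler_wpM2l a0 (ltW h1); have := ler_wpM2l a1' (ltW h2); lra.
Qed.

(** Points with infinite penalty contribute -oo and drop out once some admissible point exists. *)
Lemma FsupE e t : admissible t !=set0 ->
  Fsup X betas h e t = (supobj e t - t ^+ 2 / 2)%:E.
Proof.
move=> at0; rewrite /Fsup EFinB; congr (_ - _)%E; apply/eqP; rewrite eq_le.
apply/andP; split.
  apply: ge_ereal_sup => _ [b bt <-].
  rewrite -mulmxA trmx_mul_dotv -/(pred_err b).
  have [hb|] := ltP (h b) +oo%E.
    rewrite (finite_pen hb) -EFinB lee_fin.
    by apply: supobj_ub.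
  by rewrite leye_eq => /eqP ->; rewrite /= leNye.
have ub b : admissible t b -> ((obj e b)%:E <=
    ereal_sup [set ((e^T *m X *m (b - betas)) 0 0)%R%:E - h b |
        b in [set b | (l2norm (X *m (b - betas)) <= t)%R]])%E.
  move=> [hb bt]; apply: ereal_sup_ubound; exists b => //.
  by rewrite -mulmxA trmx_mul_dotv -/(pred_err b) {1}(finite_pen hb) -EFinB.
move: ub; set E := ereal_sup _ => ub.
case: E ub => [r| |] ub; last 2 first.
- by rewrite leey.
- by case: at0 => b /ub; rewrite leeNy_eq.
by rewrite lee_fin; apply: supobj_le.
Qed.

Lemma Fsup_not_admissible e t : ~ (admissible t !=set0) ->
  Fsup X betas h e t = -oo%E.
Proof.
move=> at0; rewrite /Fsup (_ : ereal_sup _ = -oo%E) //.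
apply/eqP; rewrite -leeNy_eq; apply: ge_ereal_sup => _ [b bt <-].
have -> : h b = +oo%E.
  apply/eqP; rewrite -leye_eq leNgt; apply/negP => hb.
  by apply: at0; exists b.
by rewrite /= leNye.
Qed.

Definition penalized_argmin e b := argmin (penalized_ls h X (X *m betas + e)) b.

Hypothesis h_proper : proper_fun h.

Lemma penalized_lsE e b : penalized_ls h X (X *m betas + e) b =
  ((l2norm (pred_err b - e) ^+ 2)%:E + 2%:E * h b)%E.
Proof. by rewrite /penalized_ls opprD addrA -mulmxBr. Qed.

Lemma argmin_finite_pen e b : penalized_argmin e b -> (h b < +oo)%E.
Proof.
move=> hb; have [b0 hb0] := h_proper.
have := hb b0; rewrite !penalized_lsE -(fineK hb0) -EFinM -EFinD => hle.
have := le_lt_trans hle (ltry _); rewrite ltNge => /negP nle.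
rewrite ltNge; apply/negP; rewrite leye_eq => /eqP hby.
by apply: nle; rewrite hby mulry gtr0_sg// mul1e addey.
Qed.

(** Expanding the square, the penalized criterion is |pred_err b|^2 - 2 obj e b + |e|^2, and |e|^2
    does not depend on b. *)
Lemma argmin_obj e bh b : penalized_argmin e bh -> (h b < +oo)%E ->
  obj e b - l2norm (pred_err b) ^+ 2 / 2 <=
  obj e bh - l2norm (pred_err bh) ^+ 2 / 2.
Proof.
move=> hbh hb; have hfin := argmin_finite_pen hbh.
have := hbh b; rewrite !penalized_lsE (finite_pen hb) (finite_pen hfin).
rewrite -!EFinM -!EFinD lee_fin /obj !l2norm_sqr !dotvBl !dotvBr.
rewrite !(dotvC _ e) => H; lra.
Qed.

(** The limit a to 0 that concludes both first-order conditions, that of the minimizer and that of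
    tf. *)
Lemma le_of_small (A B C : R) : (forall a, 0 < a <= 1 -> A <= B + a * C) -> A <= B.
Proof.
move=> H; apply/ler_addgt0Pr => r r0.
have C1 : 0 < `|C| + 1 by rewrite ltr_wpDl.
pose a := Num.min 1 (r / (`|C| + 1)).
have a0 : 0 < a by rewrite lt_min ltr01 divr_gt0.
have a1 : a <= 1 by rewrite ge_min lexx.
have ar : a * (`|C| + 1) <= r by rewrite -ler_pdivlMr// ge_min lexx orbT.
have := H a; rewrite a0 a1 => /(_ isT) H1.
have h2 : a * C <= a * `|C| by rewrite ler_wpM2l ?ler_norm// ltW.
by rewrite mulrDr mulr1 in ar; lra.
Qed.

(* First-order optimality of bh along the segment from bh to b. *)
Lemma argmin_first_order e bh b : penalized_argmin e bh -> (h b < +oo)%E ->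
  obj e b - obj e bh <= dotv (pred_err bh) (pred_err b - pred_err bh).
Proof.
move=> hbh hb; have hfin := argmin_finite_pen hbh.
set v := pred_err b - _.
apply: (@le_of_small _ _ (dotv v v / 2)) => a /andP[a0 a1].
have a01 : 0 <= a <= 1 by rewrite ltW.
have [hconv _] := finite_pen_conv a01 hb hfin.
have h1 := argmin_obj hbh hconv; have h2 := obj_conv e a01 hb hfin.
have pe : pred_err (a *: b + (1 - a) *: bh) = pred_err bh + a *: v.
  rewrite pred_err_conv /v scalerBr scalerBl scale1r.
  by rewrite addrCA.
clearbody v.
move: h1; rewrite pe !l2norm_sqr dotvDl !dotvDr !dotvZl !dotvZr (dotvC v) => h1.
have : a * (obj e b - obj e bh) <= a * (dotv (pred_err bh) v + a * (dotv v v / 2)) by lra.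
by rewrite ler_pM2l.
Qed.

(** Adding the two first-order conditions, each tested at the other minimizer, cancels the penalties
    and leaves |v1 - v2|^2 <= <e1 - e2, v1 - v2> for the prediction errors v1, v2. *)
Lemma argmin_lipschitz e1 e2 b1 b2 : penalized_argmin e1 b1 -> penalized_argmin e2 b2 ->
  l2norm (pred_err b1 - pred_err b2) <= l2norm (e1 - e2).
Proof.
move=> hb1 hb2.
have h1 := argmin_first_order hb1 (argmin_finite_pen hb2).
have h2 := argmin_first_order hb2 (argmin_finite_pen hb1).
set v1 := pred_err b1 in h1 h2 *; set v2 := pred_err b2 in h1 h2 *.
have h3 := dotv_le (e1 - e2) (v1 - v2).
have h4 : l2norm (v1 - v2) ^+ 2 <= l2norm (e1 - e2) * l2norm (v1 - v2).
  apply: le_trans h3; rewrite l2norm_sqr !dotvBl !dotvBr.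
  move: h1 h2; rewrite /obj -/v1 -/v2 !dotvBr (dotvC v2 v1); lra.
have [v0|v0] := eqVneq (l2norm (v1 - v2)) 0; first by rewrite v0 l2norm_ge0.
have vp : 0 < l2norm (v1 - v2) by rewrite lt0r v0 l2norm_ge0.
by rewrite expr2 ler_pM2r in h4.
Qed.

Lemma argmin_err_lipschitz e1 e2 b1 b2 :
  penalized_argmin e1 b1 -> penalized_argmin e2 b2 ->
  l2norm (pred_err b1) <= l2norm (pred_err b2) + 1 * l2norm (e1 - e2).
Proof.
move=> hb1 hb2; rewrite mul1r; have := argmin_lipschitz hb1 hb2.
have := l2normD (pred_err b2) (pred_err b1 - pred_err b2).
by rewrite addrC subrK; lra.
Qed.

(* The prediction error is a supergradient at itself of the concave function
   supobj e, whose slope therefore exceeds it before and is below it after. *)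
Lemma supobj_slope e bh t u : penalized_argmin e bh -> admissible t !=set0 ->
  (t < u <= l2norm (pred_err bh)) || (l2norm (pred_err bh) <= u < t) ->
  l2norm (pred_err bh) * (u - t) <= supobj e u - supobj e t.
Proof.
move=> hbh at0; set Z := l2norm (pred_err bh) => tuZ.
have aZ : admissible Z bh by split; rewrite ?(argmin_finite_pen hbh).
have Zt : Z - t != 0.
  rewrite subr_eq0; apply/eqP => Zt; move: tuZ; rewrite Zt.
  by case/orP => /andP[h1 h2]; lra.
(* The tangent line at Z: first-order optimality, with the inner product of the two prediction
   errors bounded by Z t. *)
have Sle : supobj e t <= obj e bh + Z * (t - Z).
  apply: supobj_le => // b [hb bt].
  have := argmin_first_order hbh hb.
  rewrite dotvBr -l2norm_sqr -/Z.
  have := le_trans (dotv_le (pred_err bh) (pred_err b)) (ler_wpM2l (l2norm_ge0 _) bt).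
  rewrite -/Z; lra.
have SZ := supobj_ub e aZ.
(* The weight of t in u = a t + (1 - a) Z; concavity on this segment then transports the tangent
   bound to u, on either side of Z. *)
pose a := (Z - u) / (Z - t).
have a01 : 0 <= a <= 1.
  case/orP: tuZ => /andP[h1 h2].
    have tZ : 0 < Z - t by lra.
    by rewrite /a divr_ge0 ?ler_pdivrMr//; lra.
  have tZ : 0 < t - Z by lra.
  by rewrite /a -mulrNN -invrN !opprB divr_ge0 ?ler_pdivrMr//; lra.
have ue : a * t + (1 - a) * Z = u.
  have : a * (Z - t) = Z - u by rewrite /a divfK.
  lra.
have := supobj_conv e a01 at0 (ex_intro _ _ aZ); rewrite ue => H.
have aZt : a * (Z - t) = Z - u by rewrite /a divfK.
have a1 : 0 <= 1 - a by case/andP: a01 => _; rewrite subr_ge0.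
have h1 := ler_wpM2l a1 SZ.
have h2 := ler_wpM2l a1 Sle.
have h3 : Z * (u - t) = (1 - a) * (Z * (Z - t)).
  rewrite mulrCA; congr (_ * _); rewrite mulrBl mul1r aZt; ring.
rewrite h3; lra.
Qed.

End penalized_least_squares.

(** * Tails and mean of the prediction error *)

Section deviation.
Context {R : realType} {d : measure_display} {Omega : measurableType d}.
Variables (P : probability Omega R) (n p : nat) (X : 'M[R]_(n, p))
  (betas : 'cV[R]_p) (sigma : R) (eps : Omega -> 'cV[R]_n)
  (h : 'cV[R]_p -> \bar R) (hatbeta : Omega -> 'cV[R]_p) (tf : R).
Hypotheses (sigma_gt0 : 0 < sigma) (eps_gauss : gaussian_noise P sigma eps)
  (h_ge0 : forall b, (0 <= h b)%E) (h_convex : econvex h) (h_proper : proper_fun h).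
Hypothesis h_sol : forall e, penalized_argmin X betas h e !=set0.
Hypothesis hatbetaP : forall w, penalized_argmin X betas h (eps w) (hatbeta w).
Hypothesis tc_attained : exists2 b, (h b < +oo)%E &
  l2norm (X *m (b - betas)) = tcrit X betas h.
Hypothesis tf_max : argmax_on [set t | 0 <= t] (fexp P X betas h eps) tf.

Local Notation err := (pred_err X betas).
Local Notation adm t := (admissible X betas h t !=set0).
Local Notation S := (supobj X betas h).

Let Z w := l2norm (err (hatbeta w)).

Lemma admissible_ge_tcrit t : adm t -> tcrit X betas h <= t.
Proof.
move=> [b [hb bt]]; apply: le_trans bt; apply: ge_inf; last by exists b.
by exists 0 => _ [b' _ <-]; exact: l2norm_ge0.
Qed.

(** Attainment of the infimum makes the end point admissible, so the admissible radii form a closed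
    half-line. *)
Lemma tcrit_le_admissible t : tcrit X betas h <= t -> adm t.
Proof.
by move=> tt; have [b hb bt] := tc_attained; exists b; split; rewrite ?/pred_err ?bt.
Qed.

Lemma admissible_ge0 t : adm t -> 0 <= t.
Proof. by move=> [b [_]]; apply: le_trans; exact: l2norm_ge0. Qed.

Lemma pred_err_admissible w t : Z w <= t -> adm t.
Proof.
by move=> Zt; exists (hatbeta w); split => //; exact: (argmin_finite_pen h_proper (hatbetaP w)).
Qed.

(** [hatbeta] is an arbitrary selection of minimizers, but the Lipschitz estimate at equal noise
    vectors shows that Z depends on the noise alone, and as a function of the noise it is
    1-Lipschitz. *)
Lemma pred_err_sqr_integrable : sqr_integrable P Z.
Proof.
pose phi e := l2norm (err (sval (cid (h_sol e)))).
have Lphi : lipschitzv phi.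
  exists 1 => // e1 e2; rewrite /phi.
  case: cid => b1 hb1; case: cid => b2 hb2 /=.
  exact: (argmin_err_lipschitz h_ge0 h_convex h_proper hb1 hb2).
have -> : Z = phi \o eps.
  apply/funext => w; rewrite /= /phi; case: cid => b hb /=.
  have h1 := argmin_err_lipschitz h_ge0 h_convex h_proper hb (hatbetaP w).
  have h2 := argmin_err_lipschitz h_ge0 h_convex h_proper (hatbetaP w) hb.
  by apply/eqP; rewrite eq_le; move: h1 h2; rewrite subrr l2norm0 mulr0 !addr0 => -> ->.
exact: (lipschitzv_sqr_integrable sigma_gt0 eps_gauss Lphi).
Qed.

Let I t := {b | admissible X betas h t b}.
Let a t (k : I t) := err (sval k).
Let c t (k : I t) := fine (h (sval k)).

Let a_le t (k : I t) : l2norm (a k) <= t.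
Proof. by case: k => b []. Qed.

Let S_ub t e (k : I t) : dotv e (a k) - c k <= S e t.
Proof. by case: k => b ab; exact: (supobj_ub h_ge0 e ab). Qed.

Let S_approx t (at0 : adm t) e (r : R) : 0 < r ->
  exists k : I t, S e t - r < dotv e (a k) - c k.
Proof.
move=> r0; have [b ab hb] := supobj_approx h_ge0 e at0 r0.
by exists (exist _ b ab).
Qed.

Lemma supobj_sqr_integrable t : adm t -> sqr_integrable P (fun w => S (eps w) t).
Proof.
move=> at0; apply: (lipschitzv_sqr_integrable sigma_gt0 eps_gauss (f := fun e => S e t)).
exists t; first exact: admissible_ge0.
exact: (sup_affine_lipv (@a_le t) (@S_ub t) (S_approx at0)).
Qed.

Lemma supobj_variance t : adm t ->
  \int[P]_w S (eps w) t ^+ 2 <=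
  (\int[P]_w S (eps w) t) ^+ 2 + sigma ^+ 2 * t ^+ 2.
Proof.
move=> at0; exact: (sup_affine_variance sigma_gt0 eps_gauss (admissible_ge0 at0)
  (@a_le t) (@S_ub t) (S_approx at0)).
Qed.

Let G t := \int[P]_w S (eps w) t.

Let S_int t : adm t -> P.-integrable [set: Omega] (EFin \o (fun w => S (eps w) t)).
Proof. by move=> at0; exact: sqr_integrable_integrable (supobj_sqr_integrable at0). Qed.

Lemma fexpE t : adm t -> fexp P X betas h eps t = (G t - t ^+ 2 / 2)%:E.
Proof.
move=> at0; rewrite /fexp; under eq_integral do rewrite (FsupE h_ge0 _ at0) EFinB.
have ic := finite_measure_integrable_cst P (t ^+ 2 / 2) measurableT.
rewrite integralB_EFin//; last exact: S_int.
rewrite probability_integral_cst EFinB; congr (_ - _)%E.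
by rewrite /G /Rintegral fineK//; apply: integrable_fin_num => //; exact: S_int.
Qed.

Lemma fexp_not_admissible t : ~ adm t -> fexp P X betas h eps t = -oo%E.
Proof.
move=> at0; rewrite /fexp; under eq_integral do rewrite (Fsup_not_admissible _ at0).
transitivity (-oo * P [set: Omega])%E; first exact: integral_cst.
by rewrite probability_setT mule1.
Qed.

(** [fexp] is finite at the critical radius and -oo at inadmissible radii, so no maximizer is
    inadmissible. *)
Lemma admissible_argmax : adm tf.
Proof.
have [_ tf_ge] := tf_max; have [//|ntf] := pselect (adm tf).
have atc := tcrit_le_admissible (lexx _).
have := tf_ge _ (admissible_ge0 atc).
by rewrite (fexpE atc) (fexp_not_admissible ntf) leeNy_eq.
Qed.

Let G_conv b t1 t2 : 0 <= b <= 1 -> adm t1 -> adm t2 -> adm (b * t1 + (1 - b) * t2) ->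
  b * G t1 + (1 - b) * G t2 <= G (b * t1 + (1 - b) * t2).
Proof.
move=> b01 a1 a2 a3.
have i1 := S_int a1; have i2 := S_int a2.
have z1 := integrableZl measurableT b i1.
have z2 := integrableZl measurableT (1 - b) i2.
rewrite /G -!RintegralZl// -RintegralD//.
apply: le_Rintegral => //; first exact: (integrableD measurableT z1 z2).
  exact: S_int.
by move=> w _; exact: supobj_conv.
Qed.

(** Maximality of tf is tested at tf + b (t - tf); concavity of G allows division by b, and b tends
    to 0. *)
Lemma mean_supobj_slope t : adm t -> G t - G tf <= tf * (t - tf).
Proof.
move=> at0; have atf := admissible_argmax; have [tf0 tf_ge] := tf_max.
apply: (@le_of_small _ _ _ ((t - tf) ^+ 2 / 2)) => b /andP[b0 b1].
have b01 : 0 <= b <= 1 by rewrite ltW.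
have tct := admissible_ge_tcrit at0; have tctf := admissible_ge_tcrit atf.
have au : adm (b * t + (1 - b) * tf).
  apply: tcrit_le_admissible.
  have h1 : 0 <= b * (t - tcrit X betas h) by rewrite mulr_ge0 ?subr_ge0 ?(ltW b0).
  have h2 : 0 <= (1 - b) * (tf - tcrit X betas h) by rewrite mulr_ge0 ?subr_ge0.
  lra.
have h1 := G_conv b01 at0 atf au.
have := tf_ge _ (admissible_ge0 au).
rewrite (fexpE au) (fexpE atf) lee_fin => h2.
have h3 : b * (G t - G tf) <= b * (tf * (t - tf) + b * ((t - tf) ^+ 2 / 2)) by lra.
by rewrite ler_pM2l in h3.
Qed.

Let variance_le t : adm t ->
  \int[P]_w (S (eps w) t - G t) ^+ 2 <= sigma ^+ 2 * t ^+ 2.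
Proof.
move=> at0; have st := supobj_sqr_integrable at0.
rewrite (Rintegral_sqrB st (sqr_integrable_cst P (G t))) probability_Rintegral_cst.
rewrite RintegralZr//; last exact: S_int.
have := supobj_variance at0; rewrite -/(G t); lra.
Qed.

(** Y is the difference of the centred suprema at the fixed radii t and tf; Z enters only through
    the event that t separates it from tf. *)
Lemma pred_err_deviation t : adm t -> exists Y : Omega -> R,
  [/\ sqr_integrable P Y,
      \int[P]_w Y w ^+ 2 <= 2 * sigma ^+ 2 * (t ^+ 2 + tf ^+ 2) &
      forall w, (tf < t <= Z w) || (Z w <= t < tf) ->
        (Z w - tf) * (t - tf) <= Y w].
Proof.
move=> at0; have atf := admissible_argmax.
pose U t w := S (eps w) t - G t.
have sU t' : adm t' -> sqr_integrable P (U t').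
  move=> at'; apply: sqr_integrableB; first exact: supobj_sqr_integrable.
  exact: sqr_integrable_cst.
exists (fun w => U t w - U tf w); split.
- by apply: sqr_integrableB; exact: sU.
- have sD := sqr_integrableB (sU _ at0) (sU _ atf).
  have [_ i1] := sU _ at0; have [_ i2] := sU _ atf.
  have z1 := integrableZl measurableT 2 i1; have z2 := integrableZl measurableT 2 i2.
  apply: (@le_trans _ _ (\int[P]_w (2 * U t w ^+ 2 + 2 * U tf w ^+ 2))).
    apply: le_Rintegral => //; first exact: sD.2.
      exact: (integrableD measurableT z1 z2).
    by move=> w _; have := sqr_ge0 (U t w + U tf w); lra.
  rewrite RintegralD// !RintegralZl//.
  by rewrite -mulrDr -mulrA ler_wpM2l// mulrDr lerD// variance_le.
- move=> w tZ.
  have := supobj_slope h_ge0 h_convex h_proper (hatbetaP w) atf tZ.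
  have := mean_supobj_slope at0; rewrite -/(Z w) /U; lra.
Qed.

Let mZ : measurable_fun [set: Omega] Z. Proof. exact: pred_err_sqr_integrable.1. Qed.

Let mZge r : measurable [set w | r <= Z w].
Proof.
have := mZ measurableT (measurable_itv `[r, +oo[).
by rewrite setTI; congr measurable; apply/seteqP; split => w; rewrite /= in_itv/= andbT.
Qed.

Let mZle r : measurable [set w | Z w <= r].
Proof.
have := mZ measurableT (measurable_itv `]-oo, r]).
by rewrite setTI; congr measurable; apply/seteqP; split => w; rewrite /= in_itv.
Qed.

(** On this event both factors of (Z - tf) r are at least r, so Y >= r^2 and Chebyshev produces the
    fourth power. *)
Lemma pred_err_upper_tail (r s : R) : 0 < r -> tf + r <= s ->
  (P [set w | (s <= Z w)%R] <=
   (2 * sigma ^+ 2 * ((tf + r) ^+ 2 + tf ^+ 2) / r ^+ 4)%:E)%E.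
Proof.
move=> r0 rs; have atr : adm (tf + r).
  apply: tcrit_le_admissible; apply: le_trans (admissible_ge_tcrit admissible_argmax) _.
  by rewrite lerDl ltW.
have [Y [sY Yv HY]] := pred_err_deviation atr.
rewrite -[4%N]/(2 * 2)%N exprM; apply: (chebyshev_tail (Y := Y)) => //.
  by rewrite exprn_gt0.
move=> w /(le_trans rs) Zw; apply: le_trans (HY w _); last by rewrite ltrDl r0 Zw.
have Zr : r <= Z w - tf by move: Zw => /=; lra.
by rewrite (_ : tf + r - tf = r); [rewrite expr2 ler_wpM2r ?(ltW r0)|ring].
Qed.

Lemma pred_err_lower_tail (r s : R) : 0 < r -> s <= tf - r ->
  (P [set w | (Z w <= s)%R] <=
   (2 * sigma ^+ 2 * ((tf - r) ^+ 2 + tf ^+ 2) / r ^+ 4)%:E)%E.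
Proof.
move=> r0 sr; have [atr|natr] := pselect (adm (tf - r)); last first.
  (* The prediction error is itself an admissible radius, so it never falls below an inadmissible
     one. *)
  rewrite (_ : [set w | _] = set0); last first.
    by rewrite -subset0 => w /= /le_trans /(_ sr) /pred_err_admissible.
  rewrite measure0 lee_fin divr_ge0//; last by rewrite exprn_ge0// ltW.
  by rewrite mulr_ge0 ?addr_ge0 ?sqr_ge0// mulr_ge0 ?sqr_ge0.
have [Y [sY Yv HY]] := pred_err_deviation atr.
rewrite -[4%N]/(2 * 2)%N exprM; apply: (chebyshev_tail (Y := Y)) => //.
  by rewrite exprn_gt0.
move=> w /le_trans /(_ sr) Zw; apply: le_trans (HY w _); last by rewrite Zw ltrBlDr ltrDl r0 orbT.
have Zr : r <= tf - Z w by move: Zw => /=; lra.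
rewrite (_ : (Z w - tf) * (tf - r - tf) = (tf - Z w) * r); last by ring.
by rewrite expr2 ler_wpM2r ?(ltW r0).
Qed.

(* max (a, y / a) <= a + y^2 / (4 a^3) *)
Let excess_le (r y z : R) : 0 < r -> (r <= z -> z * r <= y) ->
  z <= r + y ^+ 2 / (4 * r ^+ 3).
Proof.
move=> r0 H; have r3 : 0 < 4 * r ^+ 3 by rewrite mulr_gt0// exprn_gt0.
have [zr|rz] := ltP z r.
  by rewrite (le_trans (ltW zr))// lerDl divr_ge0 ?sqr_ge0// ltW.
rewrite -lerBlDl ler_pdivlMr//.
have h1 := H rz; have zr0 : 0 <= z * r by rewrite mulr_ge0 ?(ltW r0)// (le_trans (ltW r0)).
apply: (@le_trans _ _ ((z * r) ^+ 2)); last by rewrite lerXn2r ?nnegrE// (le_trans zr0).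
(* This is 4 r (z - r) <= z^2 multiplied by r^2. *)
have := mulr_ge0 (sqr_ge0 (z - 2 * r)) (sqr_ge0 r); lra.
Qed.

Let mean_excess_le (Y U : Omega -> R) (r v : R) : 0 < r -> sqr_integrable P Y ->
  sqr_integrable P U -> \int[P]_w Y w ^+ 2 <= v ->
  (forall w, r <= U w -> U w * r <= Y w) ->
  \int[P]_w U w <= r + v / (4 * r ^+ 3).
Proof.
move=> r0 sY sU Yv H; have r3 : 0 < 4 * r ^+ 3 by rewrite mulr_gt0// exprn_gt0.
have ic := finite_measure_integrable_cst P r measurableT.
have iz := integrableZr measurableT (4 * r ^+ 3)^-1 sY.2.
have iz' : P.-integrable [set: Omega] (EFin \o (fun w => Y w ^+ 2 / (4 * r ^+ 3))).
  exact: iz.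
apply: (@le_trans _ _ (\int[P]_w (r + Y w ^+ 2 / (4 * r ^+ 3)))).
  apply: le_Rintegral => //; first exact: sqr_integrable_integrable.
    exact: (integrableD measurableT ic iz').
  by move=> w _; apply: excess_le => //; exact: H.
rewrite RintegralD// probability_Rintegral_cst RintegralZr//; last exact: sY.2.
by rewrite lerD2l ler_wpM2r// invr_ge0 ltW.
Qed.

Let Z_cst r : sqr_integrable P (fun w => Z w - r).
Proof.
by apply: sqr_integrableB; [exact: pred_err_sqr_integrable|exact: sqr_integrable_cst].
Qed.

Let cst_Z r : sqr_integrable P (fun w => r - Z w).
Proof.
by apply: sqr_integrableB; [exact: sqr_integrable_cst|exact: pred_err_sqr_integrable].
Qed.

Let intZ := sqr_integrable_integrable pred_err_sqr_integrable.

Lemma pred_err_mean_upper (r : R) : 0 < r -> \int[P]_w Z w <=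
  tf + (r + 2 * sigma ^+ 2 * ((tf + r) ^+ 2 + tf ^+ 2) / (4 * r ^+ 3)).
Proof.
move=> r0; have atr : adm (tf + r).
  apply: tcrit_le_admissible; apply: le_trans (admissible_ge_tcrit admissible_argmax) _.
  by rewrite lerDl ltW.
have [Y [sY Yv HY]] := pred_err_deviation atr.
rewrite -lerBlDl -[X in _ - X](probability_Rintegral_cst P) -RintegralB//; last first.
  exact: finite_measure_integrable_cst.
apply: (mean_excess_le r0 sY (Z_cst tf) Yv) => w Zw.
have := HY w; rewrite (_ : tf + r - tf = r); [apply|ring].
by rewrite ltrDl r0 /=; lra.
Qed.

Lemma pred_err_mean_lower (r : R) : 0 < r -> tf - \int[P]_w Z w <=
  r + 2 * sigma ^+ 2 * ((tf - r) ^+ 2 + tf ^+ 2) / (4 * r ^+ 3).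
Proof.
move=> r0.
rewrite -[X in X - _](probability_Rintegral_cst P) -RintegralB//; last first.
  exact: finite_measure_integrable_cst.
have [atr|natr] := pselect (adm (tf - r)); last first.
  (* Z always exceeds the inadmissible radius tf - r, so tf - Z never reaches r and Y = 0 serves. *)
  have s0 := sqr_integrable_cst P 0.
  apply: (@mean_excess_le (fun=> 0)) => //.
    rewrite expr0n probability_Rintegral_cst.
    by rewrite mulr_ge0 ?addr_ge0 ?sqr_ge0// mulr_ge0 ?sqr_ge0.
  move=> w rw; exfalso; apply: natr; apply: (@pred_err_admissible w); lra.
have [Y [sY Yv HY]] := pred_err_deviation atr.
apply: (mean_excess_le r0 sY (cst_Z tf) Yv) => w Zw.
have := HY w; rewrite (_ : (Z w - tf) * (tf - r - tf) = (tf - Z w) * r); [apply|ring].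
by apply/orP; right; apply/andP; split; lra.
Qed.

End deviation.

(** * Constants *)

Section numerics.
Context {R : realType}.
Implicit Types q r l : R.

Lemma sin_le_id (x : R) : 0 <= x -> sin x <= x.
Proof.
rewrite le_eqVlt => /predU1P[<-|x0]; first by rewrite sin0.
have [|c _] := @MVT R sin cos 0 x x0 (fun y _ => is_derive_sin y).
  by apply: continuous_subspaceT => y; exact: continuous_sin.
by rewrite sin0 !subr0 => ->; rewrite ler_piMl ?cos_le1// ltW.
Qed.

Lemma cos_ge_quadratic (x : R) : 0 <= x <= 2 -> 1 - x ^+ 2 / 2 <= cos x.
Proof.
move=> /andP[x0 x2]; have x20 : 0 <= x / 2 by rewrite divr_ge0.
have s0 : 0 <= sin (x / 2).
  by apply: sin_ge0_pi; rewrite x20 /=; have := @pi_ge2 R; lra.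
have s1 : sin (x / 2) ^+ 2 <= (x / 2) ^+ 2 by rewrite lerXn2r ?nnegrE// sin_le_id.
have xE : x = (x / 2) *+ 2 by rewrite -mulr_natr divfK.
rewrite [in cos x]xE cos_mulr2n cos2sin2; lra.
Qed.

Lemma sin_ge_cubic (x : R) : 0 < x <= 2 -> x - x ^+ 3 / 6 <= sin x.
Proof.
move=> /andP[x0 x2].
pose g (y : R) := sin y - y + 6^-1 *: (y * (y * y)).
pose g' (y : R) := cos y - 1 + y ^+ 2 / 2.
have dg (y : R) : is_derive y 1 g (g' y).
  apply: (is_derive_eq (is_deriveD (is_deriveB (is_derive_sin y) (is_derive_id y 1))
    (is_deriveZ 6^-1 (is_deriveM (is_derive_id y 1)
      (is_deriveM (is_derive_id y 1) (is_derive_id y 1)))))).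
  by rewrite -[(id * id) y]/(y * y) /g' /GRing.scale /=; field.
have [|c cx] := @MVT R g g' 0 x x0 (fun y _ => dg y).
  by apply: continuous_subspaceT; exact: continuous_is_derive dg.
rewrite /g sin0 mul0r scaler0 subr0 !addr0 subr0 => e.
have : 0 <= g' c.
  move: cx; rewrite in_itv/= => /andP[c0 cx].
  have := @cos_ge_quadratic c; rewrite (ltW c0) (ltW (lt_le_trans cx x2)) => /(_ isT).
  by rewrite /g'; lra.
move=> /(mulr_ge0 (ltW x0)); rewrite mulrC -{1}[x]subr0 -e /GRing.scale /=; lra.
Qed.

(** Otherwise cos (17/10) would be positive, whereas it equals 1 - 2 sin^2 (17/20) with sin (17/20)
    >= 18/25, and 2 (18/25)^2 > 1. *)
Lemma pihalf_le_17over10 : pi / 2 <= 17 / 10 :> R.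
Proof.
rewrite leNgt; apply/negP => pi17.
have : 0 < cos (17 / 10 : R) by apply: cos_gt0_pihalf; apply/andP; split; lra.
pose x : R := 17 / 20.
have -> : 17 / 10 = x *+ 2 :> R by rewrite -mulr_natr /x; lra.
rewrite cos_mulr2n cos2sin2.
have x02 : 0 < x <= 2 by rewrite /x; apply/andP; split; lra.
have h1 : 18 / 25 <= sin x by apply: le_trans (sin_ge_cubic x02); rewrite /x; lra.
have : (18 / 25) ^+ 2 <= sin x ^+ 2 by rewrite lerXn2r ?nnegrE//; lra.
by set s := sin x; lra.
Qed.

(** The value 8/7 fits between two needs: (8/7)^4 > 17/10, and 13/4 + 8/7 < 4.40. *)
Lemma pihalf_root4_le : (pi / 2) `^ 4^-1 <= 8 / 7 :> R.
Proof.
have b0 : 0 <= 8 / 7 :> R by rewrite divr_ge0.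
have bE : ((8 / 7) ^+ 4) `^ 4^-1 = 8 / 7 :> R.
  by rewrite -powR_mulrn// -powRrM divff// powRr1.
rewrite -bE; apply: ge0_ler_powR; rewrite ?nnegrE ?invr_ge0 ?exprn_ge0//.
  by rewrite divr_ge0// pi_ge0.
by apply: le_trans pihalf_le_17over10 _; lra.
Qed.

(** Says that the tail bound at distance l is below 1/2. With x = q^2 and y = r^2 the left side is 8
    x^2 y^2 + 8 x^2 y l + 4 x^2 l^2, at most 26/441 of l^4. *)
Lemma upper_tail_const q r l : 0 < q -> 0 <= r ->
  42 * (q ^+ 2 * r ^+ 2) <= l ^+ 2 -> 21 / 2 * q ^+ 2 <= l ->
  4 * (q ^+ 2) ^+ 2 * ((r ^+ 2 + l) ^+ 2 + (r ^+ 2) ^+ 2) < l ^+ 4.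
Proof.
move=> q0 r0; set x := q ^+ 2; set y := r ^+ 2 => h1 h2.
have x0 : 0 < x by rewrite exprn_gt0.
have y0 : 0 <= y by rewrite exprn_ge0.
have l0 : 0 < l by lra.
have xy0 : 0 <= x * y by rewrite mulr_ge0// ltW.
have l20 : 0 < l ^+ 2 by rewrite exprn_gt0.
have h3 : (42 * (x * y)) * (42 * (x * y)) <= l ^+ 2 * l ^+ 2 by apply: ler_pM => //; lra.
have h4 : (42 * (x * y)) * (21 / 2 * x * l) <= l ^+ 2 * (l * l).
  apply: ler_pM => //; first lra; first by rewrite !mulr_ge0// ltW.
  by rewrite ler_pM2r.
have h5 : (21 / 2 * x) * (21 / 2 * x) <= l * l by apply: ler_pM => //; lra.
have h6 : (21 / 2 * x) * (21 / 2 * x) * l ^+ 2 <= l * l * l ^+ 2 by rewrite ler_pM2r.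
have l4 : 0 < l ^+ 4 by rewrite exprn_gt0.
lra.
Qed.

(** As (r^2 - l)^2 <= r^4, the left side is at most 8 q^4 r^4, hence at most 32/441 of l^4. *)
Lemma lower_tail_const q r l : 0 < q -> 0 <= r ->
  21 / 2 * (q ^+ 2 * r ^+ 2) <= l ^+ 2 -> 0 < l <= r ^+ 2 ->
  4 * (q ^+ 2) ^+ 2 * ((r ^+ 2 - l) ^+ 2 + (r ^+ 2) ^+ 2) < l ^+ 4.
Proof.
move=> q0 r0; set x := q ^+ 2; set y := r ^+ 2 => h1 /andP[l0 ly].
have x0 : 0 < x by rewrite exprn_gt0.
have y0 : 0 <= y by rewrite exprn_ge0.
have xy0 : 0 <= x * y by rewrite mulr_ge0// ltW.
have h3 : (21 / 2 * (x * y)) * (21 / 2 * (x * y)) <= l ^+ 2 * l ^+ 2 by apply: ler_pM => //; lra.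
have h4 : (y - l) ^+ 2 <= y ^+ 2 by apply: lerXn2r; rewrite ?nnegrE//; lra.
have h5 : x ^+ 2 * (y - l) ^+ 2 <= x ^+ 2 * y ^+ 2 by rewrite ler_wpM2l ?sqr_ge0.
have l4 : 0 < l ^+ 4 by rewrite exprn_gt0.
lra.
Qed.

(** With this l, the threshold and the remainder of the mean estimate are both of order q r for
    large r, and l stays positive at r = 0. Clearing the denominator leaves a polynomial with
    nonnegative coefficients. *)
Lemma upper_mean_const q r l : 0 < q -> 0 <= r -> l = q * (r + q) ->
  2 * (q ^+ 2) ^+ 2 * ((r ^+ 2 + l) ^+ 2 + (r ^+ 2) ^+ 2) / (4 * l ^+ 3) <=
  q * r + 3 / 2 * q ^+ 2.
Proof.
move=> q0 r0 lE; have rq0 : 0 < r + q by lra.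
have l0 : 0 < l by rewrite lE mulr_gt0.
have l30 : 0 < 4 * l ^+ 3 by rewrite mulr_gt0// exprn_gt0.
rewrite ler_pdivrMr// lE -subr_ge0.
have qr i j : 0 <= q ^+ i * r ^+ j by rewrite mulr_ge0 ?exprn_ge0// ltW.
have := qr 5%N 3%N; have := qr 6%N 2%N; have := qr 7%N 1%N; have := qr 8%N 0%N.
rewrite (_ : _ - _ = 14 * (q ^+ 5 * r ^+ 3) + 24 * (q ^+ 6 * r ^+ 2) +
  18 * (q ^+ 7 * r ^+ 1) + 4 * (q ^+ 8 * r ^+ 0)); last by field.
lra.
Qed.

(** The condition q <= r gives l <= r^2, so (r^2 - l)^2 <= r^4; the bound that remains is an
    equality. *)
Lemma lower_mean_const q r l : 0 < q -> q <= r -> l = q * r ->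
  2 * (q ^+ 2) ^+ 2 * ((r ^+ 2 - l) ^+ 2 + (r ^+ 2) ^+ 2) / (4 * l ^+ 3) <= q * r.
Proof.
move=> q0 qr lE; have r0 : 0 < r by lra.
have l0 : 0 < l by rewrite lE mulr_gt0.
have lr : l <= r ^+ 2 by rewrite lE expr2 ler_wpM2r// ltW.
have l30 : 0 < 4 * l ^+ 3 by rewrite mulr_gt0// exprn_gt0.
rewrite ler_pdivrMr// mulrC.
have h4 : (r ^+ 2 - l) ^+ 2 <= (r ^+ 2) ^+ 2 by apply: lerXn2r; rewrite ?nnegrE//; lra.
have h5 : 0 <= 2 * (q ^+ 2) ^+ 2 by rewrite mulr_ge0// sqr_ge0.
rewrite mulrC; apply: (@le_trans _ _ (2 * (q ^+ 2) ^+ 2 * (2 * (r ^+ 2) ^+ 2))).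
  by rewrite ler_wpM2l//; lra.
by rewrite lE le_eqVlt; apply/orP; left; apply/eqP; ring.
Qed.

End numerics.

Theorem theorem5p3 (R : realType) (d : measure_display)
    (Omega : measurableType d) (P : probability Omega R) (n p : nat)
    (X : 'M[R]_(n, p)) (betas : 'cV[R]_p) (sigma : R)
    (eps y : Omega -> 'cV[R]_n) (h : 'cV[R]_p -> \bar R)
    (hatbeta : Omega -> 'cV[R]_p) (tf m : R)
    (sigma_gt0 : 0 < sigma)
    (eps_gauss : gaussian_noise P sigma eps)
    (y_def : forall w, y w = X *m betas + eps w)
    (h_ge0 : forall beta, (0 <= h beta)%E)
    (h_convex : econvex h)
    (h_proper : proper_fun h)
    (h_sol : forall (A : 'M[R]_(n, p)) (z : 'cV[R]_n),
       argmin (penalized_ls h A z) !=set0)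
    (hatbeta_argmin : forall w,
       argmin (penalized_ls h X (y w)) (hatbeta w))
    (tc_attained : exists2 beta, (h beta < +oo)%E &
       l2norm (X *m (beta - betas)) = tcrit X betas h)
    (tf_unique_max :
       argmax_on [set t | 0 <= t] (fexp P X betas h eps) = [set tf])
    (m_median :
       is_median P (fun w => l2norm (X *m (hatbeta w - betas))) m) :
  [/\ `|Num.sqrt tf - Num.sqrt m| <= Num.sqrt (21 * sigma / 2),
      Num.sqrt (21 * sigma / 2) <= 325 / 100 * Num.sqrt sigma,
      (`|(Num.sqrt tf)%:E
         - sqrte ('E_P[fun w => l2norm (X *m (hatbeta w - betas))])|
       <= (Num.sqrt sigma * (Num.sqrt (21 / 2) + (pi / 2) `^ (4^-1)))%:E)%E
    & Num.sqrt sigma * (Num.sqrt (21 / 2) + (pi / 2) `^ (4^-1))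
        <= 440 / 100 * Num.sqrt sigma].
Proof.
have tf_max : argmax_on [set t | 0 <= t] (fexp P X betas h eps) tf.
  by rewrite tf_unique_max.
have hatbetaP w : penalized_argmin X betas h (eps w) (hatbeta w).
  by rewrite /penalized_argmin -y_def.
have sol e : penalized_argmin X betas h e !=set0 by exact: h_sol.
have tf0 : 0 <= tf by case: tf_max.
(* In these square roots all estimates are polynomial, and the allowed deviation is k q. *)
pose q := Num.sqrt sigma; pose r := Num.sqrt tf; pose k : R := Num.sqrt (21 / 2).
have q0 : 0 < q by rewrite sqrtr_gt0.
have r0 : 0 <= r by exact: sqrtr_ge0.
have sE : sigma = q ^+ 2 by rewrite sqr_sqrtr// ltW.
have tE : tf = r ^+ 2 by rewrite sqr_sqrtr.
have k2 : k ^+ 2 = 21 / 2 by rewrite sqr_sqrtr.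
have k0 : 0 <= k by exact: sqrtr_ge0.
have k_lt : k <= 13 / 4.
  by rewrite -(@ler_pXn2r _ 2)// ?nnegrE// k2; lra.
have k_gt : 16 / 5 <= k.
  by rewrite -(@ler_pXn2r _ 2)// ?nnegrE// k2; lra.
have kqE : Num.sqrt (21 * sigma / 2) = k * q.
  by rewrite -sqrtrM//; congr Num.sqrt; lra.
have q2 : 0 < q ^+ 2 by rewrite exprn_gt0.
have qr0 : 0 <= q * r by rewrite mulr_ge0// ltW.
have kqr0 : 0 <= k * (q * r) by rewrite mulr_ge0.
have kqkq : (k * q) ^+ 2 = 21 / 2 * q ^+ 2 by rewrite exprMn k2.
have kkqr : k * (k * (q * r)) = 21 / 2 * (q * r) by rewrite mulrA -expr2 k2.
have med_le : Num.sqrt m <= r + k * q.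
  rewrite leNgt; apply/negP => mlt.
  have rkq0 : 0 <= r + k * q by rewrite addr_ge0// mulr_ge0// ltW.
  have m0 : 0 < m by rewrite -sqrtr_gt0; exact: le_lt_trans mlt.
  (* This is (r + k q)^2 - r^2, the deviation of m from tf that the negated claim provides; a tail
     below 1/2 there contradicts the median. *)
  pose l := 2 * (k * (q * r)) + 21 / 2 * q ^+ 2.
  have l0 : 0 < l by rewrite /l; lra.
  have lm : tf + l <= m.
    have : (r + k * q) ^+ 2 < m.
      by rewrite -[m]sqr_sqrtr ?ltW// ltr_pXn2r ?nnegrE ?sqrtr_ge0.
    by rewrite sqrrD kqkq tE /l -[_ *+ 2]mulr_natl mulrCA (mulrCA r) (mulrC r) !mulrA; lra.
  have [_ med] := m_median.
  have := le_trans med (pred_err_upper_tail sigma_gt0 eps_gauss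
    h_ge0 h_convex h_proper sol hatbetaP tc_attained tf_max l0 lm).
  rewrite lee_fin leNgt => /negP; apply.
  rewrite ltr_pdivrMr ?exprn_gt0// sE tE.
  have h1 : 42 * (q ^+ 2 * r ^+ 2) <= l ^+ 2.
    have : (2 * (k * (q * r))) ^+ 2 <= l ^+ 2.
      by rewrite lerXn2r ?nnegrE ?(ltW l0) ?(mulr_ge0 _ kqr0)// /l; lra.
    by rewrite !exprMn k2; lra.
  have h2 : 21 / 2 * q ^+ 2 <= l by rewrite /l; lra.
  have := upper_tail_const q0 r0 h1 h2; lra.
have med_ge : r - k * q <= Num.sqrt m.
  rewrite leNgt; apply/negP => mlt.
  have rkq0 : 0 < r - k * q by apply: le_lt_trans mlt; exact: sqrtr_ge0.
  (* This is r^2 - (r - k q)^2; since k q < r, it is at least k q r. *)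
  pose l := 2 * (k * (q * r)) - 21 / 2 * q ^+ 2.
  have kqr : (k * q) * (k * q) <= (k * q) * r.
    by rewrite ler_wpM2l ?mulr_ge0 ?(ltW q0)//; lra.
  have l1 : k * (q * r) <= l.
    by move: kqr; rewrite -expr2 kqkq /l mulrA; lra.
  have l0 : 0 < l.
    have kq0 : 0 < k * q by rewrite mulr_gt0//; lra.
    by apply: lt_le_trans l1; rewrite mulrA mulr_gt0//; lra.
  have lE : tf - l = (r - k * q) ^+ 2.
    by rewrite sqrrB kqkq tE /l; ring.
  have lm : m <= tf - l.
    have [m0|/ltW m0] := leP m 0; first by rewrite (le_trans m0)// lE sqr_ge0.
    by rewrite lE -[m]sqr_sqrtr// lerXn2r ?nnegrE ?sqrtr_ge0// ltW.
  have [med _] := m_median.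
  have := le_trans med (pred_err_lower_tail sigma_gt0 eps_gauss
    h_ge0 h_convex h_proper sol hatbetaP tc_attained tf_max l0 lm).
  rewrite lee_fin leNgt => /negP; apply.
  rewrite ltr_pdivrMr ?exprn_gt0// sE tE.
  have h1 : 21 / 2 * (q ^+ 2 * r ^+ 2) <= l ^+ 2.
    have : (k * (q * r)) ^+ 2 <= l ^+ 2.
      by rewrite lerXn2r ?nnegrE ?(ltW l0).
    by rewrite !exprMn k2.
  have h2 : 0 < l <= r ^+ 2.
    by rewrite l0 -tE -subr_ge0 lE sqr_ge0.
  have := lower_tail_const q0 r0 h1 h2; lra.
have iZ := sqr_integrable_integrable (pred_err_sqr_integrable sigma_gt0 eps_gauss
    h_ge0 h_convex h_proper sol hatbetaP).
set EZ := \int[P]_w l2norm (pred_err X betas (hatbeta w)).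
have EE : ('E_P[fun w => l2norm (X *m (hatbeta w - betas))] = EZ%:E)%E.
  rewrite unlock /EZ /Rintegral fineK//; exact: integrable_fin_num.
have EZ0 : 0 <= EZ by apply: Rintegral_ge0 => w _; exact: l2norm_ge0.
have mean_le : Num.sqrt EZ <= r + k * q.
  have rkq0 : 0 <= r + k * q by rewrite addr_ge0// mulr_ge0// ltW.
  rewrite -(@ler_pXn2r _ 2)// ?nnegrE ?sqrtr_ge0// sqr_sqrtr//.
  have l0 : 0 < q * (r + q) by rewrite mulr_gt0// ltr_wpDl.
  apply: le_trans (pred_err_mean_upper sigma_gt0 eps_gauss
    h_ge0 h_convex h_proper sol hatbetaP tc_attained tf_max l0) _.
  (* The bound is r^2 + 2 q r + 5/2 q^2, below (r + k q)^2 because k >= 16/5. *)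
  rewrite {1}sE tE; apply: (@le_trans _ _ (r ^+ 2 + (q * (r + q) + (q * r + 3 / 2 * q ^+ 2)))).
    by rewrite !lerD2l; exact: upper_mean_const.
  have h1 : 16 / 5 * (q * r) <= k * (q * r) by rewrite ler_wpM2r.
  by rewrite sqrrD kqkq; lra.
have mean_ge : r - k * q <= Num.sqrt EZ.
  have [rkq|rkq] := leP r (k * q).
    by apply: le_trans (sqrtr_ge0 _); rewrite subr_le0.
  rewrite -(@ler_pXn2r _ 2)// ?nnegrE ?sqrtr_ge0 ?subr_ge0 ?(ltW rkq)// sqr_sqrtr//.
  have qr : q <= r.
    apply: le_trans (ltW rkq); rewrite ler_peMl ?(ltW q0)//; lra.
  have rp : 0 < r by exact: lt_le_trans qr.
  have l0 : 0 < q * r by rewrite mulr_gt0.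
  have := pred_err_mean_lower sigma_gt0 eps_gauss
    h_ge0 h_convex h_proper sol hatbetaP tc_attained tf_max l0.
  rewrite {1}sE tE -/EZ => h1.
  have h2 := lower_mean_const q0 qr (erefl (q * r)).
  have h3 : (k * q) * q <= r * q by rewrite ler_wpM2r ?(ltW q0)// ltW.
  have h4 : 16 / 5 * (q * r) <= k * (q * r) by rewrite ler_wpM2r.
  have h5 : 16 / 5 * q ^+ 2 <= k * q ^+ 2 by rewrite ler_wpM2r// ltW.
  have h6 : EZ >= r ^+ 2 - 2 * (q * r) by lra.
  (* What remains is 21/2 q^2 <= 2 (k - 1) q r, which holds because r >= k q and k >= 16/5. *)
  apply: le_trans h6; rewrite sqrrB kqkq; lra.
have root0 : 0 <= (pi / 2) `^ 4^-1 :> R by exact: powR_ge0.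
have root1 := @pihalf_root4_le R.
split.
- by rewrite kqE ler_norml; apply/andP; split; rewrite -/r; lra.
- by rewrite kqE -/q ler_wpM2r ?(ltW q0)//; lra.
- rewrite EE /= lee_fin -/q -/r -/k.
  have h1 : k * q <= q * (k + (pi / 2) `^ 4^-1).
    by rewrite mulrDr mulrC lerDl mulr_ge0// ltW.
  by rewrite ler_norml; apply/andP; split; lra.
- rewrite -/q -/k mulrC ler_wpM2r ?(ltW q0)//; lra.
Qed.
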